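(* Let $\mathbf{L}\subset\mathbb{R}^D$ be a lattice with elementary cell $\mathbf{C}$ normalized such that $|\mathbf{C}|=1$, and consider its dual lattice $\mathbf{L}^*$. Let $\alpha^*\in\mathbf{L}^*\mapsto\rho(\alpha^* )$ be any discrete (even) function satisfying $\rho\in\ell^1(\mathbf{L}^* )$, $\rho\ge0$, and $\rho(0)=1$. Then the kernel $$K^{\mathrm{per}}(x,y)=\sum_{\alpha^*\in\mathbf{L}^*}\rho(\alpha^* )e^{2i\pi\langle x-y,\alpha^*\rangle}$$ is an admissible kernel with period $\mathbf{C}$, and in the Hilbert space $\mathcal{H}_{K^{\mathrm{per}}}(\mathbf{C})$ one has $$\Big|\int_{\mathbf{C}}\varphi(x)\,dx-\frac1N\sum_{n=1}^N\varphi(y^n)\Big|\le E_K(Y,N,D)\,\|\varphi\|_{\mathcal{H}_{K^{\mathrm{per}}}(\mathbf{C})},$$ where $$E_K(Y,N,D)^2=\frac1{N^2}\sum_{n,m=1}^NK^{\mathrm{per}}(y^n,y^m)-1,$$ and $Y=(y^1,\dots,y^N)$ is any sequence of $N$ points in $\mathbf{C}$. Moreover, setting $\widetilde Y:=\arg\inf_{Y\in\mathbf{C}^N}E_K(Y,N,D)$ and $E_K(N,D):=E_K(\widetilde Y,N,D)$, one has $$E_K(N,D)^2\le\sum_{n>N}\frac{\rho(\alpha^{*n})}{N^2}\Big|\sum_{m=1}^Ne^{2i\pi\langle y^m,\alpha^{*n}\rangle}\Big|^2,$$ where the ordering $n\mapsto\alpha^{*n}$ of the points of $\mathbf{L}^*$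 is defined so that $n\mapsto\rho(\alpha^{*n})$ is a decreasing sequence, while $y^1,\dots,y^N$ are defined by solving the set of equations (when $\alpha^{*n}\ne0$) $$\sum_{m=1}^Ne^{2i\pi\langle y^m,\alpha^{*n}\rangle}=0,\qquad1\le n\le N.$$
   Context: Given vectors $l_1,\dots,l_D$ forming a basis of $\mathbb{R}^D$, $\mathbf{L}=\{\sum_d\alpha_dl_d:\alpha\in\mathbb{Z}^D\}$, $\mathbf{C}$ is the fundamental cell spanned by the $l_d$, and $\mathbf{L}^*=\{\alpha^*\in\mathbb{R}^D:\langle\alpha,\alpha^*\rangle\in\mathbb{Z}\text{ for all }\alpha\in\mathbf{L}\}$. A kernel $K$ on a set $\Omega$ is admissible if it is bounded, continuous, real-valued, symmetric ($K(x,y)=K(y,x)$), and for any collection of $N$ distinct points $y^1,\dots,y^N$ of $\Omega$ the matrix $(K(y^m,y^n))_{n,m}$ is positive definite, i.e. $\sum_{n,m}a_na_mK(y^n,y^m)>0$ for all $a\in\mathbb{R}^N\setminus\{0\}$. $\mathcal{H}_{K^{\mathrm{per}}}(\mathbf{C})$ is the reproducing kernel Hilbert space of $K^{\mathrm{per}}$, the completion of the span of the functions $K^{\mathrm{per}}(\cdot,y)$ for the inner product determined by $\langle K^{\mathrm{per}}(\cdot,x),K^{\mathrm{per}}(\cdot,y)\rangle=K^{\mathrm{per}}(x,y)$; its elements are continuous $\mathbf{L}$-periodic functions.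
   Formalization: Strict positive definiteness in ''admissible'' is proved only for ρ>0 on L*; for ρ≥0 it is only positive semidefinite, since ρ supported at 0 gives the constant kernel 1, which is not strictly positive definite. All error estimates keep ρ≥0. *)

(* Defs.v *)
From HB Require Import structures.
From mathcomp Require Import all_boot all_order all_algebra.
From mathcomp Require Import all_classical all_reals all_analysis.
From mathcomp Require Import complex.

Set Implicit Arguments.
Unset Strict Implicit.
Unset Printing Implicit Defensive.

Import Order.TTheory GRing.Theory Num.Theory.
Import numFieldNormedType.Exports.

Local Open Scope classical_set_scope.
Local Open Scope ring_scope.

Definition measure_rV_display : measure_display -> measure_display.
Proof. exact. Qed.

(* As for tuples in the library, R^n carries the sigma-algebra generated by
   the coordinates; over R it is the Borel sigma-algebra. *)
Section measurable_rV.
Context {d : measure_display} {T : measurableType d}.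
Variable n : nat.

Definition rV_coord (i : 'I_n) (v : 'rV[T]_n) : T := v ord0 i.

Let rV_set0 : g_sigma_preimage rV_coord set0.
Proof. exact: sigma_algebra0. Qed.

Let rV_setC A : g_sigma_preimage rV_coord A -> g_sigma_preimage rV_coord (~` A).
Proof. exact: sigma_algebraC. Qed.

Let rV_bigcup (F : _^nat) : (forall i, g_sigma_preimage rV_coord (F i)) ->
  g_sigma_preimage rV_coord (\bigcup_i (F i)).
Proof. exact: sigma_algebra_bigcup. Qed.

HB.instance Definition _ := @isMeasurable.Build (measure_rV_display d)
  'rV[T]_n (g_sigma_preimage rV_coord) rV_set0 rV_setC rV_bigcup.

Lemma measurable_rV_coord (i : 'I_n) :
  measurable_fun [set: 'rV[T]_n] (rV_coord i).
Proof.
move=> _ Y mY; rewrite setTI; apply: sub_sigma_algebra => /=.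
rewrite -bigcup_seq/=; exists i => /=; first by rewrite mem_index_enum.
by exists Y => //; rewrite setTI.
Qed.

Lemma measurable_fun_rV d1 (T1 : measurableType d1) (f : T1 -> 'rV[T]_n) :
  (forall i, measurable_fun [set: T1] (rV_coord i \o f)) ->
  measurable_fun [set: T1] f.
Proof.
move=> mf.
suff H : g_sigma_preimage (fun i => rV_coord i \o f) `<=` measurable.
  move=> _ A mA; apply: H; rewrite g_sigma_preimage_comp.
  by exists A.
apply: smallest_sub; first exact: sigma_algebra_measurable.
rewrite -bigcup_seq/=; apply: bigcup_sub => i _.
by move=> A [B mB <-]; exact: mf.
Qed.

End measurable_rV.

Section rV_cons.
Context {d : measure_display} {T : measurableType d}.
Variable n : nat.

Definition rV_cons (p : T * 'rV[T]_n) : 'rV[T]_n.+1 :=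
  row_mx (const_mx p.1 : 'rV[T]_1) p.2.

Definition rV_uncons (v : 'rV[T]_n.+1) : T * 'rV[T]_n :=
  (v ord0 ord0, \row_(j < n) v ord0 (lift ord0 j)).

Lemma rV_consK : cancel rV_cons rV_uncons.
Proof.
move=> [x v]; rewrite /rV_uncons; congr (_, _).
  have -> : (ord0 : 'I_n.+1) = lshift n (ord0 : 'I_1) by exact/val_inj.
  by apply: etrans (row_mxEl _ _ _ _) _; rewrite mxE.
apply/rowP => j; rewrite mxE.
have -> : lift ord0 j = rshift 1 j by exact/val_inj.
exact: row_mxEr.
Qed.

Lemma measurable_rV_cons : measurable_fun setT rV_cons.
Proof.
apply: measurable_fun_rV => i.
have [k ->|k ->] := split_ordP (i : 'I_(1 + n)).
  rewrite (_ : _ \o _ = fst) ?measurable_fst//.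
  by apply/funext => p; apply: etrans (row_mxEl _ _ _ _) _; rewrite mxE.
rewrite (_ : _ \o _ = rV_coord k \o snd).
  by apply: measurableT_comp => //; exact: measurable_rV_coord.
by apply/funext => p; exact: row_mxEr.
Qed.

Lemma measurable_rV_uncons : measurable_fun setT rV_uncons.
Proof.
apply/measurable_fun_pair => /=; first exact: (@measurable_rV_coord _ _ _ ord0).
apply: measurable_fun_rV => i.
rewrite (_ : _ \o _ = rV_coord (lift ord0 i)); first exact: measurable_rV_coord.
by apply/funext => v; rewrite /rV_coord /= mxE.
Qed.

End rV_cons.

Section lebesgue_rV.
Context {R : realType}.

Section succ.
Variables (n : nat) (m : {sigma_finite_measure set 'rV[R]_n -> \bar R}).

Definition lebesgue_rVS : set 'rV[R]_n.+1 -> \bar R :=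
  pushforward (lebesgue_measure \x m)%E (@rV_cons _ R n).

Let measurable_cons_preimage (A : set 'rV[R]_n.+1) : measurable A ->
  measurable (@rV_cons _ R n @^-1` A : set (measurableTypeR R * 'rV[R]_n)).
Proof.
by move=> mA; have := measurable_rV_cons measurableT mA; rewrite setTI.
Qed.

Let lebesgue_rVS0 : lebesgue_rVS set0 = 0%E.
Proof.
by rewrite /lebesgue_rVS /pushforward preimage_set0 (measure0 (_ \x _)%E).
Qed.

Let lebesgue_rVS_ge0 A : (0 <= lebesgue_rVS A)%E.
Proof. exact: (measure_ge0 (lebesgue_measure \x m)%E). Qed.

Let lebesgue_rVS_sigma_additive : semi_sigma_additive lebesgue_rVS.
Proof.
move=> F mF tF mUF; rewrite /lebesgue_rVS /pushforward preimage_bigcup.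
apply: (measure_semi_sigma_additive (s := (lebesgue_measure \x m)%E)).
- by move=> i; exact: measurable_cons_preimage.
- apply/trivIsetP => /= i j _ _ ij; rewrite -preimage_setI.
  by move/trivIsetP : tF => /(_ _ _ _ _ ij) ->//; rewrite preimage_set0.
- by rewrite -preimage_bigcup; exact: measurable_cons_preimage.
Qed.

HB.instance Definition _ := isMeasure.Build _ _ _ lebesgue_rVS
  lebesgue_rVS0 lebesgue_rVS_ge0 lebesgue_rVS_sigma_additive.

Let lebesgue_rVS_sigma_finite : sigma_finite setT lebesgue_rVS.
Proof.
have /sigma_finiteP[F [TF ndF Foo]] := sigma_finiteT (@lebesgue_measure R).
have /sigma_finiteP[G [TG ndG Goo]] := sigma_finiteT m.
exists (fun i => @rV_uncons _ R n @^-1` (F i `*` G i)).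
  rewrite -preimage_bigcup; apply/esym/seteqP; split=> // v _.
  have [i _ Fi] : (\bigcup_i F i) (rV_uncons v).1 by rewrite -TF.
  have [j _ Gj] : (\bigcup_i G i) (rV_uncons v).2 by rewrite -TG.
  exists (maxn i j) => //; split.
  - by move: Fi; exact/subsetPset/ndF/leq_maxl.
  - by move: Gj; exact/subsetPset/ndG/leq_maxr.
move=> i; have [mF Fi] := Foo i; have [mG Gi] := Goo i; split.
  have mFG : measurable (F i `*` G i : set (R * 'rV[R]_n)%type).
    exact: measurableX.
  by have := measurable_rV_uncons measurableT mFG; rewrite setTI.
rewrite /lebesgue_rVS /pushforward -comp_preimage.
rewrite (_ : _ \o _ = id) ?preimage_id; last first.
  by apply/funext => p /=; rewrite rV_consK.
by rewrite product_measure1E// lte_mul_pinfty// ge0_fin_numE.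
Qed.

HB.instance Definition _ := Measure_isSigmaFinite.Build _ _ _ lebesgue_rVS
  lebesgue_rVS_sigma_finite.

End succ.

Fixpoint lebesgue_rV (n : nat) : {sigma_finite_measure set 'rV[R]_n -> \bar R} :=
  if n is n'.+1 then lebesgue_rVS (lebesgue_rV n')
  else @dirac _ 'rV[R]_0 0 R.

End lebesgue_rV.

(* The basis vectors l_1, ..., l_D are the rows of the matrix [l]. *)

Section lattice.
Context {R : realType} {D : nat}.
Implicit Types (l : 'M[R]_D) (x y a : 'rV[R]_D).

Definition dotv x y : R := \sum_(i < D) x 0 i * y 0 i.

Definition lattice l : set 'rV[R]_D :=
  [set v | exists k : 'I_D -> int, v = \sum_(d < D) (k d)%:~R *: row d l].

(* The cell is half-open, so that it contains exactly one point of every class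
   modulo the lattice: with the closed parallelepiped, opposite boundary points
   are distinct and yet not separated by a periodic kernel. *)
Definition cell l : set 'rV[R]_D :=
  [set v | exists2 t : 'I_D -> R, (forall d, 0 <= t d < 1) &
           v = \sum_(d < D) t d *: row d l].

Definition dual_lattice l : set 'rV[R]_D :=
  [set a | forall v, lattice l v -> exists k : int, dotv v a = k%:~R].

(* An enumeration of the dual lattice along which [rho] is nonincreasing (it
   cannot be strictly decreasing, [rho] being even). Points where [rho] vanishes
   may be omitted: when [rho] has infinite support and vanishes somewhere, no
   enumeration of the whole dual lattice is monotone. *)
Definition decreasing_ordering l (rho : 'rV[R]_D -> R)
    (alpha : nat -> 'rV[R]_D) : Prop :=
  [/\ injective alpha,
      forall n, dual_lattice l (alpha n),
      forall a, dual_lattice l a -> rho a != 0 -> exists n, alpha n = a &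
      forall m n, (m <= n)%N -> rho (alpha n) <= rho (alpha m)].

End lattice.

(* Meaningful only for absolutely summable families. *)

Section summation.
Context {R : realType} {T : choiceType}.

Definition rsum (A : set T) (f : T -> R) : R :=
  fine (\esum_(x in A) (EFin \o f)^\+ x - \esum_(x in A) (EFin \o f)^\- x)%E.

Definition csum (A : set T) (f : T -> R[i]) : R[i] :=
  (rsum A (fun x => complex.Re (f x)) +i* rsum A (fun x => complex.Im (f x)))%C.

End summation.

Definition cis {R : realType} (t : R) : R[i] := (cos t +i* sin t)%C.

Section kernels.
Context {R : realType}.

Section kernel_on.
Context {V : topologicalType}.
Variables (Omega : set V) (K : V -> V -> R).

Definition kernel_bounded : Prop :=
  exists M : R, forall x y, Omega x -> Omega y -> `|K x y| <= M.

Definition kernel_continuous : Prop :=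
  {within Omega `*` Omega, continuous (fun p : V * V => K p.1 p.2)}.

Definition kernel_symmetric : Prop :=
  forall x y, Omega x -> Omega y -> K x y = K y x.

Definition kernel_posdef : Prop :=
  forall (N : nat) (y : 'I_N -> V) (a : 'I_N -> R),
    injective y -> (forall n, Omega (y n)) -> (exists n, a n != 0) ->
    0 < \sum_(n < N) \sum_(m < N) a n * a m * K (y n) (y m).

Definition kernel_possemidef : Prop :=
  forall (N : nat) (y : 'I_N -> V) (a : 'I_N -> R),
    (forall n, Omega (y n)) ->
    0 <= \sum_(n < N) \sum_(m < N) a n * a m * K (y n) (y m).

Definition admissible : Prop :=
  [/\ kernel_bounded, kernel_continuous, kernel_symmetric & kernel_posdef].

Definition weakly_admissible : Prop :=
  [/\ kernel_bounded, kernel_continuous, kernel_symmetric & kernel_possemidef].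

End kernel_on.

Definition periodic_kernel {D : nat} (l : 'M[R]_D)
    (K : 'rV[R]_D -> 'rV[R]_D -> R) : Prop :=
  forall v x y, lattice l v -> K (x + v) y = K x y /\ K x (y + v) = K x y.

Definition Kper_complex {D : nat} (l : 'M[R]_D) (rho : 'rV[R]_D -> R)
    (x y : 'rV[R]_D) : R[i] :=
  csum (dual_lattice l)
    (fun a => (rho a)%:C%C * cis (2 * pi * dotv (x - y) a)).

Definition Kper {D : nat} (l : 'M[R]_D) (rho : 'rV[R]_D -> R)
    (x y : 'rV[R]_D) : R := complex.Re (Kper_complex l rho x y).

(* A list [u] of pairs [(c, y)] stands for the finite combination of the
  functions [K(., y)] with coefficients [c]. The completion of the space of
  these combinations is realised as a space of functions: its elements are the
  pointwise limits of Cauchy sequences of combinations, with the limit norm. *)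
Section rkhs.
Context {T : Type}.
Variable K : T -> T -> R.

Definition comb_fun (u : seq (R * T)) : T -> R :=
  fun x => \sum_(p <- u) p.1 * K x p.2.

Definition comb_dot (u v : seq (R * T)) : R :=
  \sum_(p <- u) \sum_(q <- v) p.1 * q.1 * K p.2 q.2.

Definition comb_norm (u : seq (R * T)) : R := Num.sqrt (comb_dot u u).

Definition comb_sub (u v : seq (R * T)) : seq (R * T) :=
  u ++ [seq (- p.1, p.2) | p <- v].

Definition comb_cauchy (u : nat -> seq (R * T)) : Prop :=
  forall e : R, 0 < e -> exists n0 : nat, forall m n : nat,
    (n0 <= m)%N -> (n0 <= n)%N -> comb_norm (comb_sub (u m) (u n)) < e.

Definition rkhs_approx (phi : T -> R) (u : nat -> seq (R * T)) : Prop :=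
  comb_cauchy u /\
  forall x, comb_fun (u n) x @[n --> \oo] --> phi x.

Definition rkhs : set (T -> R) :=
  [set phi | exists u, rkhs_approx phi u].

(* The limit does not depend on the approximating sequence. *)
Definition rkhs_norm (phi : T -> R) : R :=
  get [set r | exists2 u, rkhs_approx phi u &
                          comb_norm (u n) @[n --> \oo] --> r].

End rkhs.

Section quadrature.
Context {D : nat}.
Variables (l : 'M[R]_D) (rho : 'rV[R]_D -> R) (N : nat).

Definition points_in_cell (Y : 'I_N -> 'rV[R]_D) : Prop :=
  forall n, cell l (Y n).

Definition quad_error_sqr (Y : 'I_N -> 'rV[R]_D) : R :=
  (N%:R ^+ 2)^-1 * (\sum_(n < N) \sum_(m < N) Kper l rho (Y n) (Y m)) - 1.

Definition quad_error (Y : 'I_N -> 'rV[R]_D) : R :=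
  Num.sqrt (quad_error_sqr Y).

Definition quad_argmin (Y : 'I_N -> 'rV[R]_D) : Prop :=
  points_in_cell Y /\
  forall Z, points_in_cell Z -> quad_error Y <= quad_error Z.

Definition exp_sum (y : 'I_N -> 'rV[R]_D) (a : 'rV[R]_D) : R[i] :=
  \sum_(m < N) cis (2 * pi * dotv (y m) a).

End quadrature.

End kernels.

(* Main.v *)
Require Import Defs.
From HB Require Import structures.
From mathcomp Require Import all_boot all_order all_algebra.
From mathcomp Require Import finmap.
From mathcomp Require Import all_classical all_reals all_analysis.
From mathcomp Require Import complex.
From mathcomp Require Import measurable_realfun ring lra.

(** Truncating the frequency series of the kernel to a large finite set of
dual lattice points changes it by an arbitrarily small amount, uniformly in
both variables ([rsum_approx], [Kper_approx]). Every property of the kernel is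
therefore read off from finite trigonometric sums and passed to the limit.

For a combination with coefficients c_p and points y_p, the quadratic form of
the kernel is the sum over frequencies of rho(a) |sum_p c_p e(<y_p, a>)|^2. It
dominates each of its terms ([comb_dot_ge_freq]). This one inequality gives:
- semidefiniteness of the kernel, from the frequency 0;
- strict definiteness when rho is positive: a vanishing form kills every
  Fourier coefficient, and the characters attached to distinct points of the
  cell are distinct on the dual lattice, hence linearly independent
  ([characters_independent]);
- semidefiniteness of K - 1, since the frequency 0 contributes (sum_p c_p)^2
  ([centered_psd]).

The integral of K(., y) over the cell is 1, because every nonzero frequency
integrates to 0. Moving along a basis vector by a half period of the character
changes its sign, while the integral of a lattice-periodic function over the
cell is invariant under such a move ([Rintegral_cell_shift],
[Rintegral_cell_cos]); this needs only translation invariance of the Lebesgue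
measure, and no linear change of variables.

Hence, for a combination, the quadrature error is the bilinear form of K - 1
between the combination and the uniform weights 1/N on the sample, and the
Cauchy-Schwarz inequality for K - 1 bounds it by E_K times the norm, E_K^2 being
the quadratic form of K - 1 at the uniform weights ([comb_quadrature]). Norm
convergence in the reproducing kernel space forces uniform convergence, so the
bound extends to the whole space ([rkhs_quadrature]).

E_K depends only on the classes of the points modulo the lattice and is
continuous, so its infimum over the compact closed cell is reached and can be
moved into the half-open cell ([quad_argmin_exists]). Finally E_K^2 is the sum
over nonzero frequencies of rho(a) |(1/N) sum_m e(<y_m, a>)|^2; at points
solving the equations the first N frequencies of the ordering drop out, and the
minimum is at most the value there ([quad_error_sqr_le_tail]). *)

Set Implicit Arguments.
Unset Strict Implicit.
Unset Printing Implicit Defensive.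

Import Order.TTheory GRing.Theory Num.Theory.
Import numFieldNormedType.Exports.

Local Open Scope classical_set_scope.
Local Open Scope ring_scope.

(** * Translation invariance of the Lebesgue measure *)

(** The measure structure on a pushforward takes the measurability proof as an
argument, which unification cannot supply. *)
Definition pushforward_measure d d' (R : realType)
    (T1 : measurableType d) (T2 : measurableType d')
    (m : {measure set T1 -> \bar R}) (f : T1 -> T2)
    (mf : measurable_fun [set: T1] f) : {measure set T2 -> \bar R} :=
  measure_function_pushforward__canonical__measure_function_Measure m mf.

Section translation_invariance.
Context {R : realType}.

Lemma measurable_translation1 (a : R) :
  measurable_fun [set: measurableTypeR R]
    (fun x : measurableTypeR R => (x + a : measurableTypeR R)).
Proof. exact: measurable_funD. Qed.

Lemma measurable_translation (n : nat) (v : 'rV[R]_n) :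
  measurable_fun setT (fun x : 'rV[R]_n => x + v).
Proof.
apply: measurable_fun_rV => i.
rewrite (_ : _ \o _ = fun x : 'rV[R]_n => x ord0 i + v ord0 i); last first.
  by apply/funext => x; rewrite /rV_coord /= mxE.
apply: measurable_funD => //.
exact: (measurable_rV_coord (T := measurableTypeR R)).
Qed.

Lemma lebesgue_measure_translate (a : R) (A : set (measurableTypeR R)) :
  measurable A ->
  lebesgue_measure ((fun x => x + a) @^-1` A) = lebesgue_measure A.
Proof.
move=> mA; have ma := measurable_translation1 a.
rewrite -[LHS]/(pushforward lebesgue_measure (fun x => x + a) A).
apply/esym.
apply: (lebesgue_measure_unique (mu := pushforward_measure _ ma)) => //.
move=> _ [[c d] _ <-] /=.
rewrite /pushforward /=.
rewrite (_ : _ @^-1` _ = `]c - a, d - a]%classic); last first.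
  by apply/seteqP; split => x /=; rewrite !in_itv /= ltrBlDr lerBrDr.
rewrite !lebesgue_measure_itv /= !lte_fin ltrD2r.
by case: ifP => // _; rewrite -!EFinD; congr EFin; lra.
Qed.

(** By induction on the dimension: a translation of the product acts on each
factor separately. *)
Lemma lebesgue_rV_translate (n : nat) (v : 'rV[R]_n) (A : set 'rV[R]_n) :
  measurable A -> lebesgue_rV n ((fun x => x + v) @^-1` A) = lebesgue_rV n A.
Proof.
elim: n v A => [|n IH] v A mA.
  congr (lebesgue_rV 0 _); apply/seteqP; split => x /=;
    by rewrite (_ : x + v = x)//; apply/rowP => -[].
pose w : 'rV[R]_n := \row_j v ord0 (lift ord0 j).
pose tau (p : measurableTypeR R * 'rV[R]_n) : measurableTypeR R * 'rV[R]_n :=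
  (p.1 + v ord0 ord0, p.2 + w).
have mtau : measurable_fun setT tau.
  apply/measurable_fun_pair => /=.
    by apply: measurableT_comp (measurable_translation1 _) _.
  by apply: measurableT_comp (measurable_translation w) _.
have mcA : measurable
    (@rV_cons _ R n @^-1` A : set (measurableTypeR R * 'rV[R]_n)).
  by have := measurable_rV_cons measurableT mA; rewrite setTI.
(* [rV_cons] intertwines [tau] with the translation by [v]. *)
transitivity ((lebesgue_measure \x lebesgue_rV n)%E
    (tau @^-1` (@rV_cons _ R n @^-1` A))).
  rewrite [LHS]/=/lebesgue_rVS/pushforward; congr (_ _).
  rewrite -comp_preimage -[RHS]comp_preimage; congr (_ @^-1` A).
  apply/funext => p; apply/rowP => i; rewrite mxE.
  have [k ->|k ->] := split_ordP (i : 'I_(1 + n)).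
    transitivity (p.1 + v ord0 (lshift n k)).
      by congr (_ + _); apply: etrans (row_mxEl _ _ _ _) _; rewrite mxE.
    apply: esym; apply: etrans (row_mxEl _ _ _ _) _; rewrite mxE.
    by congr (_ + v _ _); apply/val_inj; case: k => -[].
  transitivity (p.2 ord0 k + v ord0 (rshift 1 k)).
    by congr (_ + _); exact: row_mxEr.
  apply: esym; apply: etrans (row_mxEr _ _ _ _) _; rewrite !mxE.
  by congr (_ + v _ _); apply/val_inj.
apply/esym.
(* Both sides of a rectangle are translated, so the pushforward by [tau] agrees
   with the product measure on rectangles. *)
apply: (product_measure_unique (m' := pushforward_measure _ mtau)) => //=.
move=> B C mB mC; rewrite /pushforward.
rewrite (_ : tau @^-1` (B `*` C) = ((fun x => x + v ord0 ord0) @^-1` B) `*`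
  ((fun x => x + w) @^-1` C)) //.
rewrite product_measure1E.
- by congr (_ * _)%E; [exact: lebesgue_measure_translate|exact: IH].
- by rewrite -[X in measurable X]setTI; exact: measurable_translation1.
- by rewrite -[X in measurable X]setTI; exact: measurable_translation.
Qed.

End translation_invariance.

(** * Lattice coordinates and the dual lattice *)

Section dot_product.
Context {R : realType} {D : nat}.
Implicit Types (x y z a : 'rV[R]_D).

Lemma dotvDl x y a : dotv (x + y) a = dotv x a + dotv y a.
Proof.
by rewrite /dotv -big_split; apply: eq_bigr => i _; rewrite mxE mulrDl.
Qed.

Lemma dotvZl (c : R) x a : dotv (c *: x) a = c * dotv x a.
Proof.
by rewrite /dotv mulr_sumr; apply: eq_bigr => i _; rewrite mxE mulrA.
Qed.

Lemma dotvNl x a : dotv (- x) a = - dotv x a.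
Proof. by rewrite -scaleN1r dotvZl mulN1r. Qed.

Lemma dotvC x y : dotv x y = dotv y x.
Proof. by apply: eq_bigr => i _; rewrite mulrC. Qed.

Lemma dotvBl x y a : dotv (x - y) a = dotv x a - dotv y a.
Proof. by rewrite dotvDl dotvNl. Qed.

Lemma dotvNr x a : dotv x (- a) = - dotv x a.
Proof. by rewrite dotvC dotvNl dotvC. Qed.

Lemma dotvDr x a b : dotv x (a + b) = dotv x a + dotv x b.
Proof. by rewrite dotvC dotvDl !(dotvC _ x). Qed.

Lemma dotv0r x : dotv x 0 = 0.
Proof. by rewrite /dotv big1 // => i _; rewrite mxE mulr0. Qed.

Lemma dotv_suml I (s : seq I) (t : I -> R) (v : I -> 'rV[R]_D) a :
  dotv (\sum_(i <- s) t i *: v i) a = \sum_(i <- s) t i * dotv (v i) a.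
Proof.
elim: s => [|i s IH]; last by rewrite !big_cons dotvDl dotvZl IH.
by rewrite !big_nil dotvC dotv0r.
Qed.

Lemma measurable_dotv a : measurable_fun [set: 'rV[R]_D] (fun x => dotv x a).
Proof.
apply: measurable_sum => i; apply: measurable_funM => //.
exact: (measurable_rV_coord (T := measurableTypeR R)).
Qed.

Lemma continuous_dotv a : continuous (fun x : 'rV[R]_D => dotv x a).
Proof.
apply: continuous_big => [|i _ x]; first exact: add_continuous.
by apply: continuousM; [exact: coord_continuous|exact: cst_continuous].
Qed.

End dot_product.

Section lattice_coordinates.
Context {R : realType} {D : nat}.
Variable l : 'M[R]_D.
Hypothesis l_basis : row_free l.
Implicit Types (x y v a : 'rV[R]_D).

Definition dual_basis (d : 'I_D) : 'rV[R]_D := row d (invmx l)^T.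

(** Writing the coordinates of [x] in the basis [l] as dot products makes them
measurable and continuous by the lemmas on [dotv]. *)
Definition lcoord (d : 'I_D) x : R := dotv x (dual_basis d).

Let l_unit : l \in unitmx. Proof. by rewrite -row_free_unit. Qed.

Lemma lcoordD d x y : lcoord d (x + y) = lcoord d x + lcoord d y.
Proof. exact: dotvDl. Qed.

Lemma lcoord_row d e : lcoord d (row e l) = (e == d)%:R.
Proof.
have /matrixP /(_ e d) := mulmxV l_unit; rewrite !mxE => <-.
by apply: eq_bigr => i _; rewrite !mxE.
Qed.

Lemma lcoordZ_row d c e : lcoord d (c *: row e l) = c * (e == d)%:R.
Proof. by rewrite /lcoord dotvZl -/(lcoord _ _) lcoord_row. Qed.

Lemma lcoord_sum d (t : 'I_D -> R) :
  lcoord d (\sum_(e < D) t e *: row e l) = t d.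
Proof.
rewrite /lcoord dotv_suml (bigD1 d) //= -/(lcoord _ _) lcoord_row eqxx mulr1.
rewrite big1 ?addr0 // => e /negbTE ed.
by rewrite -/(lcoord _ _) lcoord_row ed mulr0.
Qed.

Lemma lcoordK x : \sum_(d < D) lcoord d x *: row d l = x.
Proof.
rewrite -[RHS](mulmxKV l_unit) [RHS]mulmx_sum_row; apply: eq_bigr => d _.
by congr (_ *: _); rewrite !mxE; apply: eq_bigr => i _; rewrite !mxE.
Qed.

Lemma lcoord_inj x y : (forall d, lcoord d x = lcoord d y) -> x = y.
Proof.
move=> xy; rewrite -[x]lcoordK -[y]lcoordK.
by apply: eq_bigr => d _; rewrite xy.
Qed.

Lemma cellP x : cell l x <-> forall d, 0 <= lcoord d x < 1.
Proof.
split=> [[t t01 ->] d|x01]; first by rewrite lcoord_sum.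
by exists (lcoord^~ x) => //; rewrite lcoordK.
Qed.

Lemma lattice_row d : lattice l (row d l).
Proof.
exists (fun e => (e == d)%:Z).
rewrite (bigD1 d) //= eqxx scale1r big1 ?addr0 //.
by move=> e /negbTE ->; rewrite scale0r.
Qed.

Lemma dual_lattice0 : dual_lattice l 0.
Proof. by move=> v _; exists 0; rewrite dotv0r. Qed.

Lemma dual_latticeN a : dual_lattice l a -> dual_lattice l (- a).
Proof. by move=> da v /da[k vak]; exists (- k); rewrite dotvNr vak rmorphN. Qed.

Lemma dual_latticeD a b :
  dual_lattice l a -> dual_lattice l b -> dual_lattice l (a + b).
Proof.
move=> da db v lv; have [[j vaj] [k vbk]] := (da _ lv, db _ lv).
by exists (j + k); rewrite dotvDr vaj vbk rmorphD.
Qed.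

Lemma dual_lattice_basis d : dual_lattice l (dual_basis d).
Proof. by move=> _ [k ->]; exists (k d); exact: lcoord_sum. Qed.

Lemma dotv_lcoord x a : dotv x a = \sum_(d < D) lcoord d x * dotv (row d l) a.
Proof. by rewrite -{1}[x]lcoordK dotv_suml. Qed.

Lemma dual_lattice_neq0 a : a != 0 -> exists d, dotv (row d l) a != 0.
Proof.
move=> a0; apply: contrapT => /forallNP h; move/negP: a0; apply; apply/eqP.
apply/rowP => i; rewrite mxE.
have -> : a 0 i = dotv (delta_mx 0 i) a.
  rewrite /dotv (bigD1 i) //= mxE !eqxx mul1r big1 ?addr0 // => j /negbTE ji.
  by rewrite mxE ji andbF mul0r.
rewrite dotv_lcoord big1 // => d _; have /negP := h d.
by rewrite negbK => /eqP ->; rewrite mulr0.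
Qed.

Lemma cell_representative x : exists2 v, lattice l v & cell l (x + v).
Proof.
exists (\sum_(d < D) (- Num.floor (lcoord d x))%:~R *: row d l).
  by exists (fun d => - Num.floor (lcoord d x)).
apply/cellP => d; rewrite lcoordD lcoord_sum rmorphN /= subr_ge0 ltrBlDr.
by rewrite addrC floor_le -[1 in X in _ < X]/(1%:~R) -rmorphD floorD1_gt.
Qed.

Lemma measurable_lcoord_itv (i : 'I_D -> interval R) :
  measurable [set x | forall d, lcoord d x \in i d].
Proof.
rewrite (_ : mkset _ = \bigcap_(d in [set: 'I_D]) (lcoord d @^-1` [set` i d])).
  apply: fin_bigcap_measurable => // d _.
  by rewrite -[X in measurable X]setTI; exact: measurable_dotv.
by apply/seteqP; split => [x h d _|x h d]; [exact: h|exact: (h d)].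
Qed.

Lemma measurable_cell : measurable (cell l).
Proof.
rewrite (_ : cell l = [set x | forall d, lcoord d x \in `[0, 1[]).
  exact: measurable_lcoord_itv.
by apply/seteqP; split => x; rewrite /= => /cellP.
Qed.

End lattice_coordinates.

Arguments dual_lattice0 {R D} l v _.
Arguments dual_lattice_basis {R D l} l_basis d v _.

(** * Integration over the cell *)

Section trigonometry.
Context {R : realType}.
Implicit Types t : R.

Lemma cosD2pi_int t (k : int) : cos (t + 2 * pi * k%:~R) = cos t.
Proof.
have h (n : nat) (u : R) : cos (u + 2 * pi * n%:R) = cos u.
  rewrite mulr_natl mulr_natr.
  exact: periodicn (@cosD2pi R) n u.
case: k => n; first exact: h.
by rewrite NegzE rmorphN /= mulrN -[LHS](h n.+1) subrK.
Qed.

(** The sign is that of the integer [k] in [Rintegral_cell_cos]. *)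
Lemma cosD_signpi t (b : bool) : cos (t + (-1) ^+ b * pi) = - cos t.
Proof.
case: b; rewrite ?expr1 ?expr0 ?mul1r ?mulN1r ?cosDpi //.
by rewrite -[RHS](congr1 -%R (congr1 cos (subrK pi t))) cosDpi opprK.
Qed.

End trigonometry.

Section integral_over_cell.
Context {R : realType} {D : nat}.
Variable l : 'M[R]_D.
Hypothesis l_basis : row_free l.
Hypothesis cell_vol : lebesgue_rV D (cell l) = 1%E.
Implicit Types (f g : 'rV[R]_D -> R) (A : set 'rV[R]_D).

Local Notation mu := (lebesgue_rV D).

Lemma measurable_bounded_integrable_rV A f M : measurable A ->
  (mu A < +oo)%E -> measurable_fun setT f -> (forall x, `|f x| <= M) ->
  mu.-integrable A (EFin \o f).
Proof.
move=> mA Afin mf fM; apply: measurable_bounded_integrable => //.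
  exact: measurable_funS mf.
exists M; split=> [|N MN x _]; first exact: num_real.
exact: le_trans (fM x) (ltW MN).
Qed.

Lemma measurable_cos_dotv (a : 'rV[R]_D) (c : R) :
  measurable_fun setT (fun x : 'rV[R]_D => cos (2 * pi * dotv x a + c)).
Proof.
apply: measurableT_comp.
  exact: continuous_measurable_fun (@continuous_cos R).
apply: measurable_funD => //; apply: measurable_funM => //.
exact: measurable_dotv.
Qed.

Lemma Rintegral_translate v A f M : measurable A ->
  (mu A < +oo)%E -> measurable_fun setT f -> (forall x, `|f x| <= M) ->
  \int[mu]_(x in (fun x : 'rV[R]_D => x + v) @^-1` A) f (x + v) =
  \int[mu]_(x in A) f x.
Proof.
move=> mA Afin mf fM; rewrite /Rintegral; congr fine.
have mtA : measurable ((fun x : 'rV[R]_D => x + v) @^-1` A).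
  by rewrite -[X in measurable X]setTI; exact: measurable_translation.
rewrite -[LHS](integral_pushforward (measurable_translation v)
  (f := EFin \o f)) //.
- apply: (@eq_measure_integral _ _ _ _ mu
    (pushforward_measure mu (measurable_translation v))) => B mB _.
  exact: lebesgue_rV_translate.
- exact/measurable_EFinP.
- apply: (@measurable_bounded_integrable_rV _ (fun x => f (x + v)) M) => //.
  + by have := lebesgue_rV_translate v mA; rewrite /= => ->.
  + exact: measurableT_comp mf (measurable_translation v).
Qed.

(** Moving the cell by [s] along [row d l] cuts off the slab where the [d]-th
coordinate is below [s] and adds the slab where it is in [1, 1 + s[; the two are
translates of each other by the lattice vector [row d l]. *)
Lemma Rintegral_cell_shift (d : 'I_D) (s : R) f M : 0 <= s < 1 ->
  measurable_fun setT f -> (forall x, `|f x| <= M) ->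
  (forall x, f (x + row d l) = f x) ->
  \int[mu]_(x in cell l) f (x + s *: row d l) = \int[mu]_(x in cell l) f x.
Proof.
move=> /andP[s0 s1] mf fM fper.
pose slab (I : interval R) := [set x : 'rV[R]_D |
  forall e, lcoord l e x \in if e == d then I else `[0, 1[].
have mslab I : measurable (slab I).
  exact: (measurable_lcoord_itv l (fun e => if e == d then I else `[0, 1[)).
have slab_fin (I : interval R) :
    (forall t : R, t \in I -> 0 <= t < 1) -> (mu (slab I) < +oo)%E.
  move=> I01; apply: (@le_lt_trans _ _ 1%E); last exact: ltry.
  rewrite -cell_vol; apply: le_measure => //; rewrite ?inE //.
    exact: measurable_cell.
  move=> x xI; apply/cellP => // e; have := xI e; case: ifP => [_|_].
    exact: I01.
  by rewrite in_itv.
have slab_translate (I J : interval R) (c : R) :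
    (forall t : R, (t \in J) = (t + c \in I)) ->
    (fun x : 'rV[R]_D => x + c *: row d l) @^-1` slab I = slab J.
  move=> IJ; apply/seteqP; split => x xJ e; have := xJ e;
    rewrite lcoordD lcoordZ_row // eq_sym; case: eqP => _;
    by rewrite ?mulr1 ?mulr0 ?addr0 // -?IJ // IJ.
have fin01 (t : R) : t \in `[0, s[ -> 0 <= t < 1.
  by rewrite in_itv /= => /andP[-> /lt_trans]; apply.
have fins1 t : t \in `[s, 1[ -> 0 <= t < 1.
  by rewrite in_itv /= => /andP[st ->]; rewrite (le_trans s0 st).
have slab0 :
    (fun x : 'rV[R]_D => x + row d l) @^-1` slab `[1, 1 + s[ = slab `[0, s[.
  rewrite -[row d l]scale1r; apply: slab_translate => t.
  by rewrite !in_itv /=; apply/andP/andP => -[? ?]; split; lra.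
have fin2 : (mu (slab `[1%R, (1 + s)%R[) < +oo)%E.
  rewrite -[X in (X < _)%E](lebesgue_rV_translate (row d l)) // slab0.
  exact: slab_fin.
have disj (I J : interval R) : (forall t : R, t \in I -> t \in J -> False) ->
    [disjoint slab I & slab J].
  move=> IJ; apply/disj_set2P/seteqP; split => // x [/= /(_ d) + /(_ d)].
  by rewrite eqxx; exact: IJ.
have cellE : cell l = slab `[0, s[ `|` slab `[s, 1[.
  apply/seteqP; split => [x /(cellP l_basis) x01|x].
    have [xs|xs] := ltP (lcoord l d x) s; [left|right] => e;
      case: eqP => [->|_]; rewrite ?in_itv //= ?xs ?andbT; by case/andP: (x01 d).
  case=> xI; apply/cellP => // e; have := xI e; case: ifP => _ //;
    rewrite in_itv // => h; [exact: fin01|exact: fins1].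
have shiftE : (fun x : 'rV[R]_D => x + s *: row d l) @^-1`
    (slab `[s, 1[ `|` slab `[1, 1 + s[) = cell l.
  rewrite preimage_setU (slab_translate _ `[0, 1 - s[); last first.
    by move=> t; rewrite !in_itv /=; apply/andP/andP => -[? ?]; split; lra.
  rewrite (slab_translate _ `[1 - s, 1[); last first.
    by move=> t; rewrite !in_itv /=; apply/andP/andP => -[? ?]; split; lra.
  apply/seteqP; split => [x|x /(cellP l_basis) x01].
    case=> xI; apply/cellP => // e; have := xI e; case: ifP => _ //;
    rewrite !in_itv /= => /andP[? ?]; apply/andP; split; lra.
  have [xs|xs] := ltP (lcoord l d x) (1 - s); [left|right] => e;
    case: eqP => [->|_]; rewrite ?in_itv //= ?xs ?andbT; by case/andP: (x01 d).
have finU I J : (mu (slab I) < +oo)%E -> (mu (slab J) < +oo)%E ->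
    (mu (slab I `|` slab J) < +oo)%E.
  move=> fI fJ; apply: le_lt_trans (measureU2 _ _ _) _ => //.
  by rewrite lte_add_pinfty.
have intU I J : (mu (slab I) < +oo)%E -> (mu (slab J) < +oo)%E ->
    mu.-integrable (slab I `|` slab J) (EFin \o f).
  move=> fI fJ; apply: measurable_bounded_integrable_rV fM => //.
    exact: measurableU.
  exact: finU.
have fin0 := slab_fin _ fin01; have fin1 := slab_fin _ fins1.
rewrite -[in LHS]shiftE (@Rintegral_translate _ _ _ M) //; first last.
- exact: finU.
- exact: measurableU.
rewrite Rintegral_setU //; first last.
- by apply: disj => t; rewrite !in_itv /=; lra.
- exact: intU.
rewrite [in RHS]cellE Rintegral_setU //; first last.
- by apply: disj => t; rewrite !in_itv /=; lra.
- exact: intU.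
rewrite addrC; congr (_ + _).
rewrite -(@Rintegral_translate (row d l) _ _ M) //.
by rewrite slab0; apply: eq_Rintegral => x _; rewrite fper.
Qed.

(** Some basis vector has a nonzero integer product [k] with [a], and moving by
1 / (2 |k|) of that vector shifts the phase by half a turn: the integral equals
its own opposite. *)
Lemma Rintegral_cell_cos (a : 'rV[R]_D) (c : R) : dual_lattice l a -> a != 0 ->
  \int[mu]_(x in cell l) cos (2 * pi * dotv x a + c) = 0.
Proof.
move=> da /(dual_lattice_neq0 l_basis)[d].
have [k dak] := da _ (lattice_row l d).
rewrite dak intr_eq0 => k0.
pose s : R := (2 * `|k%:~R|)^-1.
have k1 : 1 <= `|k%:~R| :> R.
  by rewrite -intr_norm -[1]/(1%:~R) ler_int -gtz0_ge1 normr_gt0.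
have s01 : 0 <= s < 1.
  rewrite invr_ge0 mulr_ge0 //= invf_lt1; lra.
pose f (x : 'rV[R]_D) := cos (2 * pi * dotv x a + c).
have mf : measurable_fun setT f by exact: measurable_cos_dotv.
have f1 x : `|f x| <= 1 by exact: cos_max.
have shift_neg x : f (x + s *: row d l) = - f x.
  rewrite /f dotvDl dotvZl dak -(cosD_signpi _ (k%:~R < 0 :> R)); congr cos.
  rewrite [in LHS](realEsign (num_real k%:~R)) /s; field.
  by apply/eqP => k0'; move: k1; rewrite k0'; lra.
have fper x : f (x + row d l) = f x.
  by rewrite /f dotvDl dak mulrDr -addrA (addrC _ c) addrA cosD2pi_int.
have := Rintegral_cell_shift s01 mf f1 fper.
under eq_Rintegral do rewrite shift_neg -mulN1r.
rewrite RintegralZl; last 2 first.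
- exact: measurable_cell.
- apply: measurable_bounded_integrable_rV mf f1; first exact: measurable_cell.
  by rewrite cell_vol ltry.
rewrite -/(f _); move: (\int[_]_(_ in _) _) => I; lra.
Qed.

End integral_over_cell.

Lemma measurable_fun_uniform_limit {R : realType} {d} {T : measurableType d}
    (f : T -> R) :
  (forall e, 0 < e -> exists2 g : T -> R, measurable_fun setT g &
    forall x, `|f x - g x| <= e) -> measurable_fun setT f.
Proof.
move=> fg; have /choice[g gP] : forall n : nat, exists g : T -> R,
    measurable_fun setT g /\ forall x, `|f x - g x| <= n.+1%:R^-1.
  by move=> n; have [|g mg fge] := fg n.+1%:R^-1; [rewrite invr_gt0|exists g].
apply: (@measurable_fun_cvg _ _ _ _ g) => [n|x _]; first by have [] := gP n.
apply/cvgrPdist_le => e e0; near=> n.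
apply: le_trans ((gP n).2 x) (ltW _).
by near: n; exact: (near_infty_natSinv_lt (PosNum e0)).
Unshelve. all: by end_near. Qed.

Section cell_averages.
Context {R : realType} {D : nat}.
Variable l : 'M[R]_D.
Hypothesis l_basis : row_free l.
Hypothesis cell_vol : lebesgue_rV D (cell l) = 1%E.
Implicit Types (f g : 'rV[R]_D -> R).

Local Notation mu := (lebesgue_rV D).

Lemma cell_integrable f M : measurable_fun setT f ->
  (forall x, `|f x| <= M) -> mu.-integrable (cell l) (EFin \o f).
Proof.
move=> mf fM; apply: measurable_bounded_integrable_rV mf fM.
  exact: measurable_cell.
by rewrite cell_vol ltry.
Qed.

Lemma Rintegral_cell_cst c : \int[mu]_(x in cell l) c = c.
Proof.
rewrite (Rintegral_cst mu (measurable_cell l_basis)).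
by apply: etrans (congr1 (fun t => c * fine t) cell_vol) _; rewrite mulr1.
Qed.

Lemma Rintegral_cell_dist f g M N e :
  measurable_fun setT f -> measurable_fun setT g ->
  (forall x, `|f x| <= M) -> (forall x, `|g x| <= N) ->
  (forall x, `|f x - g x| <= e) ->
  `|\int[mu]_(x in cell l) f x - \int[mu]_(x in cell l) g x| <= e.
Proof.
move=> mf mg fM gN fge; have mC := measurable_cell l_basis.
have intf := cell_integrable mf fM; have intg := cell_integrable mg gN.
rewrite -RintegralB //.
have mfg : measurable_fun setT (fun x => f x - g x) by exact: measurable_funB.
have intfg := cell_integrable mfg fge.
apply: le_trans (le_normr_Rintegral mC intfg) _.
rewrite -[leRHS]Rintegral_cell_cst; apply: le_Rintegral => //.
- apply: (@cell_integrable _ e) => [|x]; first exact: measurableT_comp.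
  by rewrite normr_id.
- by apply: (@cell_integrable _ `|e|).
Qed.

Lemma Rintegral_cell_lincomb (I : Type) (s : seq I) (c : I -> R)
    (h : I -> 'rV[R]_D -> R) M :
  (forall i, measurable_fun setT (h i)) -> (forall i x, `|h i x| <= M) ->
  \int[mu]_(x in cell l) (\sum_(i <- s) c i * h i x) =
  \sum_(i <- s) c i * \int[mu]_(x in cell l) h i x.
Proof.
move=> mh hM; have mC := measurable_cell l_basis.
have mch i : measurable_fun setT (fun x => c i * h i x).
  exact: measurable_funM.
have chM i x : `|c i * h i x| <= `|c i| * M by rewrite normrM ler_wpM2l.
elim: s => [|i s IH].
  under eq_Rintegral do rewrite big_nil.
  by rewrite big_nil Rintegral_cell_cst.
under eq_Rintegral do rewrite big_cons.
rewrite big_cons -IH RintegralD //; last 2 first.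
- exact: cell_integrable (mch i) (chM i).
- apply: (@cell_integrable _ (\sum_(j <- s) `|c j| * M)) => [|x].
    exact: measurable_sum.
  by apply: le_trans (ler_norm_sum _ _ _) _; apply: ler_sum.
by rewrite RintegralZl //; exact: cell_integrable (mh i) (hM i).
Qed.

End cell_averages.

(** * Sums over the dual lattice and their finite truncations *)

Section summable_families.
Context {R : realType} {T : choiceType}.
Implicit Types (A : set T) (w g : T -> R) (F : {fset T}).

Lemma esum_fset_split A F (h : T -> R) : [set` F] `<=` A ->
  (forall a, A a -> 0 <= h a) ->
  (\esum_(a in A) (h a)%:E =
   (\sum_(a <- F) h a)%:E + \esum_(a in A `\` [set` F]) (h a)%:E)%E.
Proof.
move=> FA h0.
rewrite (esumID [set` F]); last by move=> a Aa; rewrite lee_fin h0.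
rewrite (setIidr FA) -setDE; congr (_ + _)%E.
rewrite esum_fset //; last by move=> a /[!inE] /FA /h0; rewrite lee_fin.
by rewrite fsbig_finite //= set_fsetK sumEFin.
Qed.

(** The set [F0] depends on the weight alone: outside of it the weight has mass
at most [e], which bounds the tail of every sum of the weight against a factor
[g] of modulus at most 1. The kernels are sums of this form, with [g] depending
on the two points; this is where uniformity in the points comes from. *)
Lemma rsum_approx A w (e : R) : summable A (EFin \o w) ->
  (forall a, A a -> 0 <= w a) -> 0 < e ->
  exists2 F0 : {fset T}, [set` F0] `<=` A & forall F g, {subset F0 <= F} ->
    [set` F] `<=` A -> (forall a, A a -> `|g a| <= 1) ->
    `|rsum A (fun a => w a * g a) - \sum_(a <- F) w a * g a| <= e.
Proof.
move=> sw w0 e0.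
have absw : (\esum_(a in A) `|(EFin \o w) a| = \esum_(a in A) (w a)%:E)%E.
  by apply: eq_esum => a Aa; rewrite /= ger0_norm // w0.
have Wfin : (\esum_(a in A) (w a)%:E)%E \is a fin_num.
  by move: sw; rewrite summableE absw.
have [_ [X [finX XA] <-] ltX] := ub_ereal_sup_adherent e0 Wfin.
exists (fset_set X) => [a /=|F g F0F FA g1].
  by rewrite in_fset_set // inE => /XA.
have tail_le : (\esum_(a in A `\` [set` F]) (w a)%:E <= e%:E)%E.
  have XF : (\sum_(a \in X) (w a)%:E <= (\sum_(a <- F) w a)%:E)%E.
    rewrite -sumEFin -(set_fsetK F) -fsbig_finite //.
    apply: lee_fsum_nneg_subset => //.
      by move=> a /[!inE] Xa /=; apply: F0F; rewrite in_fset_set // inE.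
    by move=> a; rewrite inE => /andP[_] /[!inE] /FA /w0; rewrite lee_fin.
  move: ltX; rewrite lteBlDr // -[ereal_sup _]/(\esum_(a in A) (w a)%:E)%E.
  rewrite (esum_fset_split FA w0) => /ltW /le_trans /(_ (leeD2r _ XF)).
  by rewrite leeD2lE.
pose f a := w a * g a.
(* [rsum] is defined through the positive and negative parts of the summand, so
   the two tails are estimated separately. *)
pose fp a := Num.max (f a) 0; pose fn a := Num.max (- f a) 0.
have fp0 a : 0 <= fp a by rewrite /fp le_max lexx orbT.
have fn0 a : 0 <= fn a by rewrite /fn le_max lexx orbT.
have fpn a : A a -> fp a + fn a <= w a.
  move=> Aa; have -> : fp a + fn a = `|f a|.
    rewrite /fp /fn; have [f0|f0] := leP 0 (f a).
      by rewrite max_r ?oppr_le0 // addr0 ger0_norm.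
    by rewrite max_l ?oppr_ge0 ?ltW // add0r ltr0_norm.
  by rewrite normrM ger0_norm ?w0 // ler_piMr ?w0 // g1.
have tail_fin (h : T -> R) :
    (forall a, 0 <= h a) -> (forall a, A a -> h a <= w a) ->
    exists2 t : R, 0 <= t & (\esum_(a in A `\` [set` F]) (h a)%:E = t%:E)%E.
  move=> h0 hw; exists (fine (\esum_(a in A `\` [set` F]) (h a)%:E)%E).
    by rewrite fine_ge0 // esum_ge0 // => a _; rewrite lee_fin.
  rewrite fineK // ge0_fin_numE; last first.
    by rewrite esum_ge0 // => a _; rewrite lee_fin.
  apply: (@le_lt_trans _ _ e%:E); last exact: ltry.
  by apply: le_trans tail_le; apply: le_esum => a [Aa _]; rewrite lee_fin hw.
have [|p p0 tp] := tail_fin fp fp0.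
  by move=> a /fpn; have := fn0 a; lra.
have [|n n0 tn] := tail_fin fn fn0.
  by move=> a /fpn; have := fp0 a; lra.
have pn_le : p + n <= e.
  rewrite -lee_fin EFinD -tp -tn -esumD; last 2 first.
  - by move=> a _; rewrite lee_fin.
  - by move=> a _; rewrite lee_fin.
  apply: le_trans tail_le; apply: le_esum => a [Aa _].
  by rewrite -EFinD lee_fin fpn.
rewrite /rsum (eq_esum (b := fun a => (fp a)%:E)); last first.
  by move=> a _; rewrite funeposE /= EFin_max.
rewrite [X in (_ - X)%E](eq_esum (b := fun a => (fn a)%:E)); last first.
  by move=> a _; rewrite funenegE /= EFin_max EFinN.
rewrite (esum_fset_split FA) // (esum_fset_split (h := fn) FA) // tp tn.
rewrite -!EFinD /=.
have -> : \sum_(a <- F) w a * g a = \sum_(a <- F) fp a - \sum_(a <- F) fn a.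
  rewrite -sumrB; apply: eq_bigr => a _; rewrite -/(f a) /fp /fn.
  have [f0|f0] := leP 0 (f a); first by rewrite max_r ?oppr_le0 // subr0.
  by rewrite max_l ?oppr_ge0 ?ltW // sub0r opprK.
rewrite ler_norml; lra.
Qed.

(** The positive and the negative part have the same sum, finite or not: in the
infinite case [fine] sends the difference to 0. *)
Lemma rsum_odd A (s : T -> T) (f : T -> R) :
  set_bij A A s -> (forall a, A a -> f (s a) = - f a) -> rsum A f = 0.
Proof.
move=> sA fs; rewrite /rsum (reindex_esum A A s) //.
rewrite (eq_esum (b := (EFin \o f)^\-%E)); last first.
  by move=> a Aa; rewrite funeposE funenegE /= fs.
by case: (esum _ _) => [r||] //=; rewrite subrr.
Qed.

Lemma eq_rsum A (f g : T -> R) : (forall a, A a -> f a = g a) ->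
  rsum A f = rsum A g.
Proof.
move=> fg; rewrite /rsum; congr (fine (_ - _)%E); apply: eq_esum => a Aa;
  by rewrite ?funeposE ?funenegE /= fg.
Qed.

End summable_families.

(** * The periodic kernel and its Fourier form *)

Section periodic_kernel_expansion.
Context {R : realType} {D : nat}.
Variables (l : 'M[R]_D) (rho : 'rV[R]_D -> R).
Hypothesis rho_even : forall a, dual_lattice l a -> rho (- a) = rho a.
Hypothesis rho_l1 : summable (dual_lattice l) (EFin \o rho).
Hypothesis rho_ge0 : forall a, dual_lattice l a -> 0 <= rho a.
Implicit Types (x y a : 'rV[R]_D) (F : {fset 'rV[R]_D}).

Local Notation K := (Kper l rho).

(** The sine series is odd in the frequency, as [rho] is even. *)
Lemma Kper_complexE x y : Kper_complex l rho x y = (K x y)%:C%C.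
Proof.
rewrite /Kper /Kper_complex /csum /=; congr (_ +i* _)%C.
apply: (rsum_odd (s := -%R)).
  split => [a|a b _ _|a da]; [exact: dual_latticeN|exact: oppr_inj|].
  by exists (- a); [exact: dual_latticeN|rewrite opprK].
move=> a da /=; rewrite rho_even // dotvNr mulrN sinN.
by rewrite !mul0r !addr0 mulrN.
Qed.

Lemma KperE x y :
  K x y =
  rsum (dual_lattice l) (fun a => rho a * cos (2 * pi * dotv (x - y) a)).
Proof. by apply: eq_rsum => a _ /=; rewrite mul0r subr0. Qed.

Definition Kper_trunc F x y : R :=
  \sum_(a <- F) rho a * cos (2 * pi * dotv (x - y) a).

Lemma Kper_approx (e : R) : 0 < e ->
  exists2 F0 : {fset 'rV[R]_D}, [set` F0] `<=` dual_lattice l &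
    forall F x y, {subset F0 <= F} ->
    [set` F] `<=` dual_lattice l -> `|K x y - Kper_trunc F x y| <= e.
Proof.
move=> e0; have [F0 F0l h] := rsum_approx rho_l1 rho_ge0 e0.
exists F0 => // F x y F0F Fl; rewrite KperE; apply: h => // a _.
exact: cos_max.
Qed.

(** Keeping a prescribed frequency in the truncation makes its contribution
visible in lower bounds and in integrals. *)
Lemma Kper_approx_at (e : R) a : dual_lattice l a -> 0 < e ->
  exists F : {fset 'rV[R]_D}, [/\ [set` F] `<=` dual_lattice l, a \in F &
    forall x y, `|K x y - Kper_trunc F x y| <= e].
Proof.
move=> da e0; have [F0 F0l h] := Kper_approx e0.
have Fl : [set` (a |` F0)%fset] `<=` dual_lattice l.
  by move=> b /= /fset1UP[->//|]; exact: F0l.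
exists (a |` F0)%fset; split => //; first exact: fset1U1.
by move=> x y; apply: h => // b bF0; rewrite fset1Ur.
Qed.

Lemma Kper_sym x y : K x y = K y x.
Proof.
by rewrite !KperE; apply: eq_rsum => a _; rewrite -opprB dotvNl mulrN cosN.
Qed.

Lemma Kper_periodic : periodic_kernel l K.
Proof.
move=> v x y lv.
split; rewrite !KperE; apply: eq_rsum => a /(_ v lv)[k vk]; congr (_ * _).
  by rewrite addrAC (dotvDl (x - y)) vk mulrDr cosD2pi_int.
by rewrite opprD addrA (dotvBl (x - y)) vk -rmorphN mulrDr cosD2pi_int.
Qed.

(** Squared modulus of the Fourier coefficient at [a] of the discrete measure
with weights and points [u], split into its real and imaginary parts. *)
Definition comb_freq (u : seq (R * 'rV[R]_D)) a : R :=
  (\sum_(p <- u) p.1 * cos (2 * pi * dotv p.2 a)) ^+ 2 +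
  (\sum_(p <- u) p.1 * sin (2 * pi * dotv p.2 a)) ^+ 2.

Lemma comb_freq_ge0 u a : 0 <= comb_freq u a.
Proof. by rewrite addr_ge0 // sqr_ge0. Qed.

Lemma comb_dot_trunc F u :
  comb_dot (Kper_trunc F) u u = \sum_(a <- F) rho a * comb_freq u a.
Proof.
rewrite /comb_dot /Kper_trunc.
under eq_bigr do under eq_bigr do rewrite mulr_sumr.
under eq_bigr do rewrite exchange_big.
rewrite exchange_big; apply: eq_bigr => a _ /=.
have expand (c s : 'rV[R]_D -> R) :
    (\sum_(p <- u) p.1 * c p.2) ^+ 2 + (\sum_(p <- u) p.1 * s p.2) ^+ 2 =
    \sum_(p <- u) \sum_(q <- u) p.1 * q.1 * (c p.2 * c q.2 + s p.2 * s q.2).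
  rewrite !expr2 !mulr_suml -big_split; apply: eq_bigr => p _ /=.
  by rewrite !mulr_sumr -big_split; apply: eq_bigr => q _ /=; ring.
rewrite /comb_freq (expand (fun x => cos (2 * pi * dotv x a))
  (fun x => sin (2 * pi * dotv x a))) mulr_sumr; apply: eq_bigr => p _.
rewrite mulr_sumr; apply: eq_bigr => q _.
by rewrite dotvBl mulrBr cosB; ring.
Qed.

Lemma comb_dot_approx F u (e : R) :
  (forall x y, `|K x y - Kper_trunc F x y| <= e) ->
  `|comb_dot K u u - comb_dot (Kper_trunc F) u u| <=
    (\sum_(p <- u) `|p.1|) ^+ 2 * e.
Proof.
move=> KF; rewrite /comb_dot -sumrB expr2 !mulr_suml.
apply: le_trans (ler_norm_sum _ _ _) _; apply: ler_sum => p _.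
rewrite -mulrA mulr_suml mulr_sumr -sumrB.
apply: le_trans (ler_norm_sum _ _ _) _; apply: ler_sum => q _.
by rewrite -mulrBr !normrM -mulrA ler_wpM2l // ler_wpM2l.
Qed.

(** For a truncation containing [a] the quadratic form is a sum of nonnegative
terms, among which the one at [a]; the truncation error tends to 0. *)
Lemma comb_dot_ge_freq u a : dual_lattice l a ->
  rho a * comb_freq u a <= comb_dot K u u.
Proof.
move=> da; set S := (\sum_(p <- u) `|p.1|) ^+ 2.
have S0 : 0 <= S by exact: sqr_ge0.
apply/ler_addgt0Pr => e e0.
have e1 : 0 < e / (S + 1) by rewrite divr_gt0 // ltr_pwDr.
have [F [Fl aF KF]] := Kper_approx_at da e1.
have := comb_dot_approx u KF; rewrite -/S comb_dot_trunc => /ler_normlP[].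
rewrite opprB lerBlDr => + _ => h1.
have h2 : rho a * comb_freq u a <= \sum_(a <- F) rho a * comb_freq u a.
  rewrite (big_fsetD1 a aF) /= lerDl big_seq sumr_ge0 // => b /fsetD1P[_ bF].
  by rewrite mulr_ge0 ?comb_freq_ge0 // rho_ge0 //; exact: Fl.
apply: (le_trans h2); apply: (le_trans h1); rewrite addrC lerD2l.
rewrite mulrCA ler_piMr // ?(ltW e0) // ler_pdivrMr ?mul1r ?lerDl //.
by rewrite ltr_pwDr.
Qed.

End periodic_kernel_expansion.

(** * Semidefinite kernels and their Hilbert space *)

Section semidefinite_kernels.
Context {R : realType} {T : Type}.
Variable K : T -> T -> R.
Implicit Types (u v w : seq (R * T)) (x y : T).

Definition comb_scale (c : R) u : seq (R * T) := [seq (c * p.1, p.2) | p <- u].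

Lemma comb_subE u v : comb_sub u v = u ++ comb_scale (-1) v.
Proof. by congr (_ ++ _); apply: eq_map => p; rewrite mulN1r. Qed.

Lemma comb_dot_catl u v w :
  comb_dot K (u ++ v) w = comb_dot K u w + comb_dot K v w.
Proof. by rewrite /comb_dot big_cat. Qed.

Lemma comb_dot_scalel c u w :
  comb_dot K (comb_scale c u) w = c * comb_dot K u w.
Proof.
rewrite /comb_dot big_map mulr_sumr; apply: eq_bigr => p _.
by rewrite mulr_sumr; apply: eq_bigr => q _ /=; rewrite !mulrA.
Qed.

Lemma comb_fun_sub u v x :
  comb_fun K (comb_sub u v) x = comb_fun K u x - comb_fun K v x.
Proof.
rewrite comb_subE /comb_fun big_cat big_map -sumrN; congr (_ + _).
by apply: eq_bigr => p _; rewrite mulN1r mulNr.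
Qed.

Hypothesis K_sym : forall x y, K x y = K y x.
Hypothesis K_psd : forall u, 0 <= comb_dot K u u.

Lemma comb_dotC u v : comb_dot K u v = comb_dot K v u.
Proof.
rewrite /comb_dot exchange_big; apply: eq_bigr => p _; apply: eq_bigr => q _.
by rewrite K_sym (mulrC q.1).
Qed.

Lemma comb_dot_quadratic u v c : comb_dot K (u ++ comb_scale c v)
    (u ++ comb_scale c v) =
  comb_dot K u u + 2 * c * comb_dot K u v + c ^+ 2 * comb_dot K v v.
Proof.
rewrite comb_dot_catl comb_dot_scalel.
rewrite (comb_dotC u) (comb_dotC v) !comb_dot_catl !comb_dot_scalel.
by rewrite (comb_dotC v u); ring.
Qed.

Lemma comb_dot_cauchy_schwarz u v :
  comb_dot K u v ^+ 2 <= comb_dot K u u * comb_dot K v v.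
Proof.
have q c :
    0 <= comb_dot K u u + 2 * c * comb_dot K u v + c ^+ 2 * comb_dot K v v.
  by rewrite -comb_dot_quadratic.
move: (K_psd u) (K_psd v) q.
move: (comb_dot K u u) (comb_dot K u v) (comb_dot K v v) => a b c a0 c0 q.
have [c00|cN0] := eqVneq c 0.
  (* The quadratic polynomial is then affine; unless its slope [2 * b] vanishes,
     it takes the value -1. *)
  have [->|bN0] := eqVneq b 0; first by rewrite c00 mulr0 expr0n.
  have := q (- (a + 1) / (2 * b)); rewrite c00 mulr0 addr0.
  rewrite (_ : 2 * _ * b = - (a + 1)); last by field.
  lra.
have cgt0 : 0 < c by rewrite lt_neqAle eq_sym cN0.
have := q (- b / c).
rewrite (_ : a + _ + _ = (a * c - b ^+ 2) / c); last by field.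
by rewrite pmulr_lge0 ?invr_gt0 // subr_ge0.
Qed.

Lemma comb_norm_ge0 u : 0 <= comb_norm K u.
Proof. exact: sqrtr_ge0. Qed.

Lemma comb_norm_sqr u : comb_norm K u ^+ 2 = comb_dot K u u.
Proof. by rewrite sqr_sqrtr. Qed.

Lemma normr_comb_dot_le u v :
  `|comb_dot K u v| <= comb_norm K u * comb_norm K v.
Proof.
rewrite -sqrtrM // -sqrtr_sqr ler_sqrt; first exact: comb_dot_cauchy_schwarz.
by rewrite mulr_ge0.
Qed.

Lemma comb_norm_sub u v :
  `|comb_norm K u - comb_norm K v| <= comb_norm K (comb_sub u v).
Proof.
rewrite -(ler_pXn2r (n := 2)) ?nnegrE ?comb_norm_ge0 // real_normK ?num_real //.
rewrite comb_norm_sqr comb_subE comb_dot_quadratic.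
have := normr_comb_dot_le u v; rewrite ler_norml => /andP[_ h].
rewrite sqrrB !comb_norm_sqr; lra.
Qed.

(** Evaluation at [x] is the form against the combination (1, x), so that norm
bounds are pointwise bounds. *)
Lemma comb_fun_le u x : `|comb_fun K u x| <= Num.sqrt (K x x) * comb_norm K u.
Proof.
have -> : comb_fun K u x = comb_dot K [:: (1, x)] u.
  by rewrite /comb_dot big_seq1; apply: eq_bigr => p _; rewrite mul1r.
apply: le_trans (normr_comb_dot_le _ _) _; rewrite /comb_norm.
by rewrite {1}/comb_dot !big_seq1 /= !mul1r.
Qed.

(** [rkhs_norm] is chosen among the limits of norms; norms along a Cauchy
sequence converge, so the choice is made in a nonempty set and comes with a
sequence realizing it. *)
Lemma rkhs_norm_approx (phi : T -> R) : rkhs K phi ->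
  exists2 u, rkhs_approx K phi u &
    comb_norm K (u n) @[n --> \oo] --> rkhs_norm K phi.
Proof.
move=> [u uphi]; pose r := limn (fun n => comb_norm K (u n)).
have r_lim : comb_norm K (u n) @[n --> \oo] --> r.
  apply/cauchy_cvgP/cauchy_exP => e e0.
  have [n0 h] := uphi.1 _ e0; exists (comb_norm K (u n0)).
  exists n0 => // n n0n; apply: le_lt_trans (comb_norm_sub _ _) _.
  by apply: h => //=.
have /getPex[v vphi vr] : exists r,
    [set r : R | exists2 u, rkhs_approx K phi u &
    comb_norm K (u n) @[n --> \oo] --> r] r by exists r, u.
by exists v.
Qed.

(** [comb_fun_le] makes the sequence of functions uniformly Cauchy when the
diagonal of the kernel is bounded. *)
Lemma rkhs_approx_uniform (phi : T -> R) (u : nat -> seq (R * T)) (M : R) :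
  (forall x, K x x <= M) -> rkhs_approx K phi u ->
  forall e, 0 < e -> exists n0, forall n, (n0 <= n)%N ->
    forall x, `|phi x - comb_fun K (u n) x| <= e.
Proof.
move=> KM [uC ucvg] e e0; set s := Num.sqrt M.
have s0 : 0 <= s by exact: sqrtr_ge0.
have e1 : 0 < e / (s + 1) by rewrite divr_gt0 // ltr_pwDr.
have [n0 h] := uC _ e1; exists n0 => n n0n x.
apply/ler_addgt0Pr => d d0.
have /cvgrPdist_lt /(_ _ d0) [m0 _ hm] := ucvg x.
have m := hm (maxn m0 n0) (leq_maxl _ _).
rewrite -[phi x](subrK (comb_fun K (u (maxn m0 n0)) x)) -addrA addrC.
apply: le_trans (ler_normD _ _) _; rewrite lerD //; last exact: ltW.
rewrite -comb_fun_sub; apply: le_trans (comb_fun_le _ _) _.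
apply: (@le_trans _ _ (s * (e / (s + 1)))).
  apply: ler_pM; rewrite ?sqrtr_ge0 ?comb_norm_ge0 ?ler_wsqrtr //.
  by rewrite ltW // h // leq_maxr.
by rewrite mulrCA ler_piMr ?(ltW e0) // ler_pdivrMr ?mul1r ?lerDl // ltr_pwDr.
Qed.

End semidefinite_kernels.

(** * Admissibility of the periodic kernel *)

Section characters.

(** Induction on the number of characters: translating a relation by [b] and
subtracting [chi i b] times it removes the character [i] and multiplies the
coefficient of [k] by [chi k b - chi i b]. *)
Lemma characters_independent (C : idomainType) (G : zmodType) (A : set G)
    (I : eqType) (chi : I -> G -> C) (s : seq I) (c : I -> C) :
  A 0 -> (forall a b, A a -> A b -> A (a + b)) ->
  (forall i, chi i 0 = 1) ->
  (forall i a b, chi i (a + b) = chi i a * chi i b) ->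
  (forall i j, i != j -> exists2 b, A b & chi i b != chi j b) ->
  uniq s -> (forall a, A a -> \sum_(i <- s) c i * chi i a = 0) ->
  forall i, i \in s -> c i = 0.
Proof.
move=> A0 AD chi0 chiD sep; elim: s c => // i s IH c /= /andP[nis us] rel.
have cs0 j : j \in s -> c j = 0.
  move=> js; have ji : j != i by apply: contra nis => /eqP <-.
  have [b Ab bij] := sep _ _ ji.
  apply/eqP; have := IH (fun k => c k * (chi k b - chi i b)) us _ j js.
  move=> /(_ _)/eqP; rewrite mulf_eq0 subr_eq0 (negbTE bij) orbF; apply => a Aa.
  transitivity (\sum_(k <- s) c k * chi k (a + b) -
      chi i b * \sum_(k <- s) c k * chi k a).
    by rewrite mulr_sumr -sumrB; apply: eq_bigr => k _; rewrite chiD; ring.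
  have := rel _ (AD _ _ Aa Ab); have := rel _ Aa; rewrite !big_cons chiD.
  move=> /eqP; rewrite addrC addr_eq0 => /eqP ->.
  by move=> /eqP; rewrite addrC addr_eq0 => /eqP ->; ring.
move=> j; rewrite inE => /predU1P[->|/cs0 //].
have := rel _ A0; rewrite big_cons chi0 mulr1 big_seq big1 ?addr0 // => k ks.
by rewrite cs0 // mul0r.
Qed.

End characters.

Section cis.
Context {R : realType}.
Implicit Types s t : R.

Lemma cisD s t : cis (s + t) = cis s * cis t.
Proof. by rewrite /cis cosD sinD; congr (_ +i* _)%C; rewrite addrC. Qed.

Lemma cis0 : cis (0 : R) = 1.
Proof. by rewrite /cis cos0 sin0. Qed.

(** Two equal values give cos (2 d) = 1 with d = pi (t - s) in [0, pi[, that is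
sin d = 0. *)
Lemma cis2pi_inj s t : 0 <= s < 1 -> 0 <= t < 1 ->
  cis (2 * pi * s) = cis (2 * pi * t) -> s = t.
Proof.
wlog st : s t / s <= t => [H s01 t01 e|].
  by have [/H|/ltW/H] := leP s t; [exact|move=> h; apply/esym/h].
move=> /andP[s0 s1] /andP[t0 t1] [ec es].
have [//|sNt] := eqVneq s t.
have st' : s < t by rewrite lt_neqAle sNt.
have pi0 : 0 < pi :> R := pi_gt0 R.
have : cos (2 * pi * t - 2 * pi * s) = 1.
  by rewrite cosB ec es -!expr2 cos2Dsin2.
rewrite (_ : _ - _ = (pi * (t - s)) *+ 2); last by rewrite mulr2n; ring.
rewrite cos_mulr2n cos2sin2 => /eqP.
have : 0 < sin (pi * (t - s)).
  apply: sin_gt0_pi; rewrite mulr_gt0 ?subr_gt0 //=.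
  by rewrite -[ltRHS]mulr1 ltr_pM2l //; lra.
move=> sin0 /eqP; have := exprn_gt0 2 sin0; lra.
Qed.

End cis.

Section periodic_kernel_properties.
Context {R : realType} {D : nat}.
Variables (l : 'M[R]_D) (rho : 'rV[R]_D -> R).
Hypothesis l_basis : row_free l.
Hypothesis rho_l1 : summable (dual_lattice l) (EFin \o rho).
Hypothesis rho_ge0 : forall a, dual_lattice l a -> 0 <= rho a.
Implicit Types (x y a : 'rV[R]_D) (u v : seq (R * 'rV[R]_D)).

Local Notation K := (Kper l rho).

Lemma Kper_psd u : 0 <= comb_dot K u u.
Proof.
apply: (le_trans _ (comb_dot_ge_freq rho_l1 rho_ge0 u (dual_lattice0 l))).
by rewrite mulr_ge0 ?comb_freq_ge0 // rho_ge0 //; exact: dual_lattice0.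
Qed.

Lemma Kper_diag x : K x x = K 0 0.
Proof. by rewrite !KperE !subrr. Qed.

Lemma Kper_diag_ge0 : 0 <= K 0 0.
Proof.
by have := Kper_psd [:: (1, 0)]; rewrite /comb_dot !big_seq1 !mul1r.
Qed.

(** Cauchy-Schwarz inequality; the diagonal of the kernel is constant. *)
Lemma Kper_le_diag x y : `|K x y| <= K 0 0.
Proof.
have := comb_fun_le (@Kper_sym _ _ l rho) Kper_psd [:: (1, y)] x.
rewrite /comb_fun /comb_norm /comb_dot !big_seq1 /= !mul1r !Kper_diag.
by rewrite -expr2 sqr_sqrtr // Kper_diag_ge0.
Qed.

(** The finite truncations see the points only through their dot products with
fixed vectors, and they converge uniformly. *)
Lemma continuous_Kper_comp (S : topologicalType) (f g : S -> 'rV[R]_D) :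
  (forall a, continuous (fun s => dotv (f s) a)) ->
  (forall a, continuous (fun s => dotv (g s) a)) ->
  continuous (fun s => K (f s) (g s)).
Proof.
move=> cf cg p; apply/cvgrPdist_le => e e0.
have e3 : 0 < e / 3 by rewrite divr_gt0.
have [F [_ _ KF]] := Kper_approx_at rho_l1 rho_ge0 (dual_lattice0 l) e3.
have cF : continuous (fun s => Kper_trunc rho F (f s) (g s)).
  apply: continuous_big => [|a _ {}p]; first exact: add_continuous.
  apply: continuousM; first exact: cst_continuous.
  apply: (@continuous_comp _ _ _
    (fun s => 2 * pi * dotv (f s - g s) a) cos); last exact: continuous_cos.
  apply: continuousM; first exact: cst_continuous.
  rewrite (_ : (fun _ => _) = fun s => dotv (f s) a - dotv (g s) a); last first.
    by apply/funext => s; exact: dotvBl.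
  by apply: continuousB; [exact: cf|exact: cg].
have /cvgrPdist_le /(_ _ e3) := cF p.
apply: filterS => q; rewrite /= => hq.
have := KF (f p) (g p); have := KF (f q) (g q); move: hq.
rewrite !ler_norml; lra.
Qed.

Lemma continuous_Kper :
  continuous (fun p : 'rV[R]_D * 'rV[R]_D => K p.1 p.2).
Proof.
apply: continuous_Kper_comp => a p.
  by apply: (@continuous_comp _ _ _ fst (fun x : 'rV[R]_D => dotv x a));
    [exact: cvg_fst|exact: continuous_dotv].
by apply: (@continuous_comp _ _ _ snd (fun x : 'rV[R]_D => dotv x a));
  [exact: cvg_snd|exact: continuous_dotv].
Qed.

Lemma comb_dot_family (N : nat) (y : 'I_N -> 'rV[R]_D) (a : 'I_N -> R)
    (H : 'rV[R]_D -> 'rV[R]_D -> R) :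
  comb_dot H [seq (a n, y n) | n <- index_enum 'I_N]
    [seq (a n, y n) | n <- index_enum 'I_N] =
  \sum_(n < N) \sum_(m < N) a n * a m * H (y n) (y m).
Proof.
by rewrite /comb_dot big_map; apply: eq_bigr => n _; rewrite big_map.
Qed.

Lemma Kper_weakly_admissible : weakly_admissible setT K.
Proof.
split.
- by exists (K 0 0) => x y _ _; exact: Kper_le_diag.
- by apply: continuous_subspaceT; exact: continuous_Kper.
- by move=> x y _ _; exact: Kper_sym.
- by move=> N y a _; rewrite -comb_dot_family; exact: Kper_psd.
Qed.

(** Each difference of characters is detected by a vector of the dual basis,
whose product with a point of the cell is a coordinate in [0, 1[. *)
Lemma Kper_admissible : (forall a, dual_lattice l a -> 0 < rho a) ->
  admissible (cell l) K.
Proof.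
move=> rho_gt0; have [[M KM] _ _ _] := Kper_weakly_admissible; split.
- by exists M => x y _ _; exact: KM.
- by apply: continuous_subspaceT; exact: continuous_Kper.
- by move=> x y _ _; exact: Kper_sym.
move=> N y a y_inj y_cell [n0 an0].
rewrite -comb_dot_family; set u := map _ _.
rewrite lt_neqAle Kper_psd andbT; apply: contra an0 => /eqP K0.
have freq0 b : dual_lattice l b -> comb_freq u b = 0.
  move=> db; apply/eqP; rewrite eq_le comb_freq_ge0 andbT.
  have := comb_dot_ge_freq rho_l1 rho_ge0 u db; rewrite -K0.
  by rewrite pmulr_rle0 // rho_gt0.
have chi0 (n : 'I_N) : cis (2 * pi * dotv (y n) 0) = 1.
  by rewrite dotv0r mulr0 cis0.
have := @characters_independent _ _ (dual_lattice l) _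
  (fun (n : 'I_N) b => cis (2 * pi * dotv (y n) b)) (index_enum 'I_N)
  (fun n => (a n)%:C%C) (dual_lattice0 l) (@dual_latticeD _ _ l) chi0.
move=> /(_ _ _ _ _ n0 (mem_index_enum _)) H.
have : (a n0)%:C%C = 0.
  apply: H => [n b c|n m nm||b db].
  - by rewrite dotvDr mulrDr cisD.
  - apply: contrapT => /forall2NP h; move/eqP: nm; apply; apply: y_inj.
    apply: (lcoord_inj l_basis) => d.
    have [/(_ (dual_lattice_basis l_basis d))//|/negP] := h (dual_basis l d).
    rewrite negbK => /eqP; apply: cis2pi_inj.
      by have /(cellP l_basis) := y_cell n; exact.
    by have /(cellP l_basis) := y_cell m; exact.
  - exact: index_enum_uniq.
  - have := freq0 _ db; rewrite /comb_freq !big_map /= => /eqP.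
    rewrite paddr_eq0 ?sqr_ge0 // !sqrf_eq0 => /andP[/eqP c0 /eqP s0].
    apply/eqP; rewrite eq_complex; apply/andP; split; apply/eqP.
      rewrite raddf_sum -[RHS]c0; apply: eq_bigr => n _ /=.
      by rewrite mul0r subr0.
    rewrite raddf_sum -[RHS]s0; apply: eq_bigr => n _ /=.
    by rewrite mul0r addr0.
by case=> ->.
Qed.

End periodic_kernel_properties.

(** * The quadrature error *)

Section quadrature_error.
Context {R : realType} {D : nat}.
Variables (l : 'M[R]_D) (rho : 'rV[R]_D -> R).
Hypothesis l_basis : row_free l.
Hypothesis cell_vol : lebesgue_rV D (cell l) = 1%E.
Hypothesis rho_l1 : summable (dual_lattice l) (EFin \o rho).
Hypothesis rho_ge0 : forall a, dual_lattice l a -> 0 <= rho a.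
Hypothesis rho_0 : rho 0 = 1.
Implicit Types (x y a : 'rV[R]_D) (u v : seq (R * 'rV[R]_D)).

Local Notation K := (Kper l rho).
Local Notation mu := (lebesgue_rV D).

Lemma measurable_Kper_trunc F y :
  measurable_fun setT (fun x => Kper_trunc rho F x y).
Proof.
apply: measurable_sum => a; apply: measurable_funM => //.
rewrite (_ : (fun _ => _) = fun x =>
    cos (2 * pi * dotv x a + - (2 * pi * dotv y a))).
  exact: measurable_cos_dotv.
by apply/funext => x; rewrite dotvBl mulrBr.
Qed.

Lemma measurable_Kper y : measurable_fun setT (K ^~ y).
Proof.
apply: measurable_fun_uniform_limit => e e0.
have [F [_ _ KF]] := Kper_approx_at rho_l1 rho_ge0 (dual_lattice0 l) e0.
by exists (fun x => Kper_trunc rho F x y); first exact: measurable_Kper_trunc.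
Qed.

Lemma Rintegral_Kper_trunc F y : [set` F] `<=` dual_lattice l -> 0 \in F ->
  \int[mu]_(x in cell l) Kper_trunc rho F x y = 1.
Proof.
move=> Fl F0; pose h a x := cos (2 * pi * dotv x a + - (2 * pi * dotv y a)).
transitivity (\int[mu]_(x in cell l) (\sum_(a <- F) rho a * h a x)).
  apply: eq_Rintegral => x _; apply: eq_bigr => a _.
  by rewrite dotvBl mulrBr.
rewrite (@Rintegral_cell_lincomb _ _ _ l_basis cell_vol _ _ _ _ 1); first last.
- by move=> a x; exact: cos_max.
- by move=> a; exact: measurable_cos_dotv.
rewrite (big_fsetD1 0 F0) /= rho_0 mul1r.
rewrite [X in _ + X]big_seq big1 ?addr0; last first.
  move=> a /fsetD1P[a0 aF].
  by rewrite (Rintegral_cell_cos l_basis cell_vol) ?mulr0 //; exact: Fl.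
rewrite -[RHS](Rintegral_cell_cst l_basis cell_vol); apply: eq_Rintegral => x _.
by rewrite /h !dotv0r !mulr0 oppr0 addr0 cos0.
Qed.

Lemma Rintegral_Kper y : \int[mu]_(x in cell l) K x y = 1.
Proof.
apply/eqP; rewrite -subr_eq0 -normr_le0; apply/ler_addgt0Pr => e e0.
have [F [Fl F0 KF]] := Kper_approx_at rho_l1 rho_ge0 (dual_lattice0 l) e0.
rewrite add0r -(Rintegral_Kper_trunc y Fl F0).
apply: (Rintegral_cell_dist l_basis cell_vol (M := K 0 0)
  (N := K 0 0 + e)) => //.
- exact: measurable_Kper.
- exact: measurable_Kper_trunc.
- by move=> x; exact: Kper_le_diag.
- move=> x; have := KF x y; have := Kper_le_diag rho_l1 rho_ge0 x y.
  by rewrite !ler_norml; lra.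
Qed.

Lemma measurable_comb_fun u : measurable_fun setT (comb_fun K u).
Proof.
apply: measurable_sum => p; apply: measurable_funM => //.
exact: measurable_Kper.
Qed.

Lemma comb_fun_bounded u x :
  `|comb_fun K u x| <= \sum_(p <- u) `|p.1| * K 0 0.
Proof.
apply: le_trans (ler_norm_sum _ _ _) _; apply: ler_sum => p _.
by rewrite normrM ler_wpM2l // Kper_le_diag.
Qed.

Lemma Rintegral_comb_fun u :
  \int[mu]_(x in cell l) comb_fun K u x = \sum_(p <- u) p.1.
Proof.
rewrite (@Rintegral_cell_lincomb _ _ _ l_basis cell_vol _ u fst
  (fun p x => K x p.2) (K 0 0)).
- by apply: eq_bigr => p _; rewrite Rintegral_Kper mulr1.
- by move=> p; exact: measurable_Kper.
- by move=> p x; exact: Kper_le_diag.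
Qed.

(* The kernel with its frequency 0 removed. *)
Local Notation K1 := (fun x y => K x y - 1).

Lemma comb_dot_centered u v :
  comb_dot K1 u v = comb_dot K u v - (\sum_(p <- u) p.1) * (\sum_(p <- v) p.1).
Proof.
rewrite /comb_dot mulr_suml -sumrB; apply: eq_bigr => p _.
by rewrite mulr_sumr -sumrB; apply: eq_bigr => q _; rewrite mulrBr mulr1.
Qed.

Lemma comb_freq0 u : comb_freq u 0 = (\sum_(p <- u) p.1) ^+ 2.
Proof.
rewrite /comb_freq; under eq_bigr do rewrite dotv0r mulr0 cos0 mulr1.
under [X in _ + X ^+ 2]eq_bigr do rewrite dotv0r mulr0 sin0 mulr0.
by rewrite [X in _ + X ^+ 2]big1 // expr0n addr0.
Qed.

(** The frequency 0 alone contributes (sum of the weights)^2, which is what the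
constant 1 takes away. *)
Lemma centered_psd u : 0 <= comb_dot K1 u u.
Proof.
have := comb_dot_ge_freq rho_l1 rho_ge0 u (dual_lattice0 l).
by rewrite rho_0 mul1r comb_freq0 comb_dot_centered subr_ge0 -expr2.
Qed.

Definition sample N (Y : 'I_N -> 'rV[R]_D) (c : R) : seq (R * 'rV[R]_D) :=
  [seq (c, Y n) | n <- index_enum 'I_N].

Lemma sum_sample N (Y : 'I_N -> 'rV[R]_D) : (0 < N)%N ->
  \sum_(p <- sample Y N%:R^-1) p.1 = 1 :> R.
Proof.
move=> N0; rewrite big_map /= sumr_const card_ord -[LHS]mulr_natr mulVf //.
by rewrite pnatr_eq0 -lt0n.
Qed.

Lemma quad_error_sqrE N (Y : 'I_N -> 'rV[R]_D) : (0 < N)%N ->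
  quad_error_sqr l rho Y = comb_dot K1 (sample Y N%:R^-1) (sample Y N%:R^-1).
Proof.
move=> N0; rewrite comb_dot_centered !sum_sample // mulr1; congr (_ - 1).
rewrite comb_dot_family mulr_sumr; apply: eq_bigr => n _.
by rewrite mulr_sumr; apply: eq_bigr => m _; rewrite expr2 invfM.
Qed.

Lemma quad_error_sqr_ge0 N (Y : 'I_N -> 'rV[R]_D) : (0 < N)%N ->
  0 <= quad_error_sqr l rho Y.
Proof. by move=> N0; rewrite quad_error_sqrE // centered_psd. Qed.

(** The sum of the weights of [u] is the integral of its function. As the
weights of the sample add up to 1, the error is, up to sign, the form of K - 1
between the sample and [u]; and the form of K - 1 at [u] is at most that of K.
*)
Lemma comb_quadrature N (Y : 'I_N -> 'rV[R]_D) u : (0 < N)%N ->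
  `|\sum_(p <- u) p.1 - N%:R^-1 * \sum_(n < N) comb_fun K u (Y n)|
  <= quad_error l rho Y * comb_norm K u.
Proof.
move=> N0; have K1_sym x y : K1 x y = K1 y x by rewrite Kper_sym.
have := normr_comb_dot_le K1_sym centered_psd (sample Y N%:R^-1) u.
rewrite {1}comb_dot_centered sum_sample // mul1r distrC.
have -> : comb_norm K1 (sample Y N%:R^-1) = quad_error l rho Y.
  by rewrite /comb_norm -quad_error_sqrE.
have -> : comb_dot K (sample Y N%:R^-1) u =
    N%:R^-1 * \sum_(n < N) comb_fun K u (Y n).
  rewrite /comb_dot big_map mulr_sumr; apply: eq_bigr => n _.
  by rewrite mulr_sumr; apply: eq_bigr => q _; rewrite mulrA.
move=> /le_trans; apply; rewrite ler_wpM2l ?sqrtr_ge0 // ler_wsqrtr //.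
by rewrite comb_dot_centered gerBl -expr2 sqr_ge0.
Qed.

(** Both sides of the bound for combinations converge along a sequence that
approximates [phi] in norm, hence uniformly. *)
Lemma rkhs_quadrature N (Y : 'I_N -> 'rV[R]_D) (phi : 'rV[R]_D -> R) :
  (0 < N)%N -> rkhs K phi ->
  `|\int[mu]_(x in cell l) phi x - N%:R^-1 * \sum_(n < N) phi (Y n)|
  <= quad_error l rho Y * rkhs_norm K phi.
Proof.
move=> N0 /(rkhs_norm_approx (@Kper_sym _ _ l rho) (Kper_psd rho_l1 rho_ge0)).
move=> [u uphi unorm].
have Kdiag x : K x x <= K 0 0 by rewrite Kper_diag.
have unif := rkhs_approx_uniform (@Kper_sym _ _ l rho)
  (Kper_psd rho_l1 rho_ge0) Kdiag uphi.
have mphi : measurable_fun setT phi.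
  apply: measurable_fun_uniform_limit => e /unif[n /(_ _ (leqnn n)) phie].
  by exists (comb_fun K (u n)) => //; exact: measurable_comb_fun.
set E := quad_error l rho Y; have E0 : 0 <= E by exact: sqrtr_ge0.
(* An error [d] is made on the integral, on the sample average and on the norm;
   the last one is multiplied by [E]. *)
apply/ler_addgt0Pr => e e0; pose d := e / (2 + E).
have E2 : 0 < 2 + E by rewrite ltr_wpDr.
have d0 : 0 < d by rewrite divr_gt0.
have [n0 hn0] := unif _ d0.
have /cvgrPdist_le /(_ _ d0) [n1 _ hn1] := unorm.
pose n := maxn n0 n1.
have near_phi x := hn0 n (leq_maxl _ _) x.
have near_norm := hn1 n (leq_maxr _ _).
have phi_bounded x : `|phi x| <= d + \sum_(p <- u n) `|p.1| * K 0 0.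
  have := comb_fun_bounded (u n) x; have := near_phi x.
  by rewrite !ler_norml; lra.
have h1 := Rintegral_cell_dist l_basis cell_vol mphi (measurable_comb_fun (u n))
  phi_bounded (comb_fun_bounded (u n)) near_phi.
rewrite Rintegral_comb_fun in h1.
have h2 := comb_quadrature Y (u n) N0.
have h3 : `|N%:R^-1 * \sum_(m < N) comb_fun K (u n) (Y m) -
    N%:R^-1 * \sum_(m < N) phi (Y m)| <= d.
  rewrite -mulrBr -sumrB normrM ger0_norm ?invr_ge0 // ler_pdivrMl ?ltr0n //.
  apply: le_trans (ler_norm_sum _ _ _) _.
  rewrite mulrC mulr_natr -[X in _ *+ X]card_ord -sumr_const.
  by apply: ler_sum => m _; rewrite distrC.
have h4 : E * comb_norm K (u n) <= E * rkhs_norm K phi + E * d.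
  rewrite -mulrDr ler_wpM2l //; move: near_norm; rewrite /= ler_norml; lra.
have de : e = 2 * d + E * d by rewrite /d; field; rewrite gt_eqF.
rewrite de; move: h1 h2 h3 h4; rewrite -/E !ler_norml.
move: (E * d) (E * comb_norm _ _) (E * rkhs_norm _ _) => ? ? ?.
lra.
Qed.

End quadrature_error.

(** * Optimal points and the ordering of the frequencies *)

Section optimal_points.
Context {R : realType} {D : nat}.
Variables (l : 'M[R]_D) (rho : 'rV[R]_D -> R).
Hypothesis l_basis : row_free l.
Hypothesis rho_l1 : summable (dual_lattice l) (EFin \o rho).
Hypothesis rho_ge0 : forall a, dual_lattice l a -> 0 <= rho a.
Hypothesis rho_0 : rho 0 = 1.

Local Notation K := (Kper l rho).

Lemma quad_error_sqrK N (Y : 'I_N -> 'rV[R]_D) : (0 < N)%N ->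
  quad_error l rho Y ^+ 2 = quad_error_sqr l rho Y.
Proof. by move=> N0; rewrite sqr_sqrtr // quad_error_sqr_ge0. Qed.

Lemma quad_error_periodic N (Y v : 'I_N -> 'rV[R]_D) :
  (forall n, lattice l (v n)) ->
  quad_error l rho (fun n => Y n + v n) = quad_error l rho Y.
Proof.
move=> lv; rewrite /quad_error /quad_error_sqr.
congr (Num.sqrt (_ * _ - 1)); apply: eq_bigr => n _; apply: eq_bigr => m _.
have [-> _] := Kper_periodic rho (Y n) (Y m + v m) (lv n).
by have [_ ->] := Kper_periodic rho (Y n) (Y m) (lv m).
Qed.

Lemma quad_error_representative N (Y : 'I_N -> 'rV[R]_D) :
  exists2 Z : 'I_N -> 'rV[R]_D, points_in_cell l Z &
    quad_error l rho Z = quad_error l rho Y.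
Proof.
have /choice[v vP] n : exists v, lattice l v /\ cell l (Y n + v).
  by have [v] := cell_representative l_basis (Y n); exists v.
exists (fun n => Y n + v n); first by move=> n; have [] := vP n.
by apply: quad_error_periodic => n; have [] := vP n.
Qed.

(** The half-open cell is not compact, but the closed one is the image of a cube
of coordinates, and a minimizer over the closed cell has a representative in
the half-open one with the same error. *)
Lemma quad_argmin_exists N : exists Y : 'I_N -> 'rV[R]_D, quad_argmin l rho Y.
Proof.
pose pts (t : 'rV[R]_(N * D)) (n : 'I_N) : 'rV[R]_D :=
  \sum_(d < D) t ord0 (mxvec_index n d) *: row d l.
pose cube := [set t : 'rV[R]_(N * D) |
  forall i, (`[0, 1]%classic : set R) (t ord0 i)].
have cubeC : compact cube.
  apply: (@rV_compact R (N * D) (fun=> `[0, 1]%classic)) => i.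
  exact: segment_compact.
have cube0 : cube !=set0.
  by exists 0 => i; rewrite /= mxE in_itv /= lexx ler01.
have cpts n a : continuous (fun t => dotv (pts t n) a).
  rewrite (_ : (fun _ => _) = fun t : 'rV[R]_(N * D) =>
    \sum_(d < D) t ord0 (mxvec_index n d) * dotv (row d l) a); last first.
    by apply/funext => t; exact: dotv_suml.
  apply: continuous_big => [|d _ t]; first exact: add_continuous.
  apply: (@continuousM _ _ (fun t : 'rV[R]_(N * D) => t ord0 (mxvec_index n d))
    (fun=> dotv (row d l) a)); last exact: cst_continuous.
  exact: coord_continuous.
have cq : continuous (fun t => quad_error l rho (pts t)).
  move=> t; apply: (@continuous_comp _ _ _
    (fun t => quad_error_sqr l rho (pts t)) Num.sqrt); last first.
    exact: sqrt_continuous.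
  apply: continuousB; last exact: cst_continuous.
  apply: continuousM; first exact: cst_continuous.
  apply: continuous_big => [|n _]; first exact: add_continuous.
  apply: continuous_big => [|m _]; first exact: add_continuous.
  exact: continuous_Kper_comp.
have [c _ cmin] := compact_EVT_min cube0 cubeC (continuous_subspaceT cq).
have [Y Ycell YE] := quad_error_representative (pts c).
exists Y; split => // Z Zcell; rewrite YE.
pose t : 'rV[R]_(N * D) := mxvec (\matrix_(n, d) lcoord l d (Z n)).
have -> : Z = pts t.
  apply/funext => n; rewrite /pts -{1}[Z n](lcoordK l_basis).
  by apply: eq_bigr => d _; rewrite mxvecE mxE.
apply: cmin; rewrite inE => i; case/mxvec_indexP: i => n d.
rewrite /= mxvecE mxE in_itv /=.
by have /(cellP l_basis)/(_ d)/andP[-> /ltW ->] := Zcell n.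
Qed.

Lemma comb_freq_sample N (y : 'I_N -> 'rV[R]_D) a :
  comb_freq (sample y N%:R^-1) a =
  ComplexField.Normc.normc (exp_sum y a) ^+ 2 / N%:R ^+ 2.
Proof.
rewrite /comb_freq !big_map -!mulr_sumr !exprMn -mulrDr mulrC exprVn.
congr (_ / _); rewrite /exp_sum.
have -> : \sum_(m < N) cis (2 * pi * dotv (y m) a) =
  ((\sum_(m < N) cos (2 * pi * dotv (y m) a)) +i*
   (\sum_(m < N) sin (2 * pi * dotv (y m) a)))%C.
  apply/eqP; rewrite eq_complex !raddf_sum /=.
  by rewrite !eqxx.
by rewrite /= sqr_sqrtr // addr_ge0 // sqr_ge0.
Qed.

(** A nonzero frequency of the truncation with a nonzero term lies in the support
of [rho], hence in the ordering, and not among the first [N] points, where the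
exponential sum vanishes. The sum over the truncation is thus at most the sum
over the tail of the ordering. The frequency 0, where the term is 1, accounts
for the 1 subtracted in the squared error. *)
Lemma quad_error_sqr_le_tail N (alpha : nat -> 'rV[R]_D)
    (y : 'I_N -> 'rV[R]_D) : (0 < N)%N -> decreasing_ordering l rho alpha ->
  (forall n : nat, (n < N)%N -> alpha n != 0 -> exp_sum y (alpha n) = 0) ->
  ((quad_error_sqr l rho y)%:E <=
   \sum_(N <= n <oo)
     (rho (alpha n) * comb_freq (sample y N%:R^-1) (alpha n))%:E)%E.
Proof.
move=> N0 [alpha_inj alpha_dual alpha_supp _] y0.
set w := sample y N%:R^-1; pose t a := rho a * comb_freq w a.
have t0 a : dual_lattice l a -> 0 <= t a.
  by move=> da; rewrite mulr_ge0 ?rho_ge0 // comb_freq_ge0.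
rewrite eseries_cond.
rewrite -[leRHS](_ : \esum_(a in alpha @` (fun n => N <= n)%N) (t a)%:E = _)%E;
    last first.
  apply: (@esum_pred_image _ _ (fun a => (t a)%:E) alpha (fun n => N <= n)%N).
    by move=> n _; rewrite lee_fin t0.
  by move=> m n _ _; exact: alpha_inj.
apply/lee_addgt0Pr => e e0.
have [F [Fl F0 KF]] := Kper_approx_at rho_l1 rho_ge0 (dual_lattice0 l) e0.
have wsum : \sum_(p <- w) `|p.1| = 1.
  rewrite -[RHS](sum_sample y N0) !big_map; apply: eq_bigr => n _ /=.
  by rewrite ger0_norm.
have := comb_dot_approx w KF; rewrite wsum expr1n mul1r comb_dot_trunc.
rewrite (big_fsetD1 0 F0) /= rho_0 mul1r comb_freq0 (sum_sample _ N0) expr1n.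
have -> : comb_dot K w w = quad_error_sqr l rho y + 1.
  by rewrite quad_error_sqrE // comb_dot_centered (sum_sample _ N0) mulr1 subrK.
rewrite ler_norml => /andP[_ h].
have h' : quad_error_sqr l rho y <= \sum_(a <- (F `\ 0)%fset) t a + e.
  by move: h; rewrite -/(t _) lerBlDr; lra.
apply: (@le_trans _ _ (\sum_(a <- (F `\ 0)%fset) t a + e)%:E).
  by rewrite lee_fin.
rewrite EFinD leeD2r //.
have FDl : [set` (F `\ 0)%fset] `<=` dual_lattice l.
  by move=> a /= /fsetD1P[_]; exact: Fl.
rewrite -sumEFin -{1}(set_fsetK (F `\ 0)%fset) -fsbig_finite //.
rewrite -esum_fset //; last first.
  by move=> a; rewrite inE => /FDl /t0; rewrite lee_fin.
(* Extended by 0, both sums run over all vectors and are compared termwise. *)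
rewrite esum_mkcond [leRHS]esum_mkcond; apply: le_esum => a _.
case: ifPn => [aF|_]; last first.
  by case: ifPn => // /[!inE] -[n _ <-]; rewrite lee_fin t0.
case: ifPn => // aN.
have [->|ta] := eqVneq (t a) 0; first by [].
have aF' : a \in (F `\ 0)%fset by rewrite inE in aF.
have /fsetD1P[a0 aF2] := aF'.
have [n an] : exists n, alpha n = a.
  apply: alpha_supp; first exact: Fl.
  by apply: contra ta; rewrite /t => /eqP ->; rewrite mul0r.
have [Nn|nN] := leqP N n.
  by move/negP: aN; case; apply/mem_set; exists n.
move/eqP: ta; case; rewrite /t /w comb_freq_sample -an y0 ?an //.
by rewrite /= expr0n addr0 sqrtr0 expr0n mul0r mulr0.
Qed.

End optimal_points.

(* Strict positive definiteness fails when rho vanishes on too many dual lattice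
   points (e.g. when rho is supported at 0, where the kernel is constant), so it
   is asserted for positive rho; everything else holds for nonnegative rho.
   [alpha n] is the (n+1)-st point of the ordering. *)
Theorem proposition6p5 (R : realType) (D : nat) (l : 'M[R]_D)
    (rho : 'rV[R]_D -> R)
    (l_basis : row_free l)
    (cell_vol : lebesgue_rV D (cell l) = 1%E)
    (rho_even : forall a, dual_lattice l a -> rho (- a) = rho a)
    (rho_l1 : summable (dual_lattice l) (EFin \o rho))
    (rho_ge0 : forall a, dual_lattice l a -> 0 <= rho a)
    (rho_0 : rho 0 = 1) :
  [/\ forall x y, Kper_complex l rho x y = (Kper l rho x y)%:C%C,
      weakly_admissible setT (Kper l rho),
      (forall a, dual_lattice l a -> 0 < rho a) ->
        admissible (cell l) (Kper l rho),
      periodic_kernel l (Kper l rho) &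
      forall N : nat, (0 < N)%N ->
      [/\ forall Y : 'I_N -> 'rV[R]_D, points_in_cell l Y ->
            quad_error l rho Y ^+ 2 =
            (N%:R ^+ 2)^-1 *
              (\sum_(n < N) \sum_(m < N) Kper l rho (Y n) (Y m)) - 1,
          forall (phi : 'rV[R]_D -> R) (Y : 'I_N -> 'rV[R]_D),
            rkhs (Kper l rho) phi -> points_in_cell l Y ->
            `|\int[lebesgue_rV D]_(x in cell l) phi x
              - N%:R^-1 * \sum_(n < N) phi (Y n)|
            <= quad_error l rho Y * rkhs_norm (Kper l rho) phi,
          exists Yt : 'I_N -> 'rV[R]_D, quad_argmin l rho Yt &
          forall (Yt : 'I_N -> 'rV[R]_D) (alpha : nat -> 'rV[R]_D)
                 (y : 'I_N -> 'rV[R]_D),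
            quad_argmin l rho Yt ->
            decreasing_ordering l rho alpha ->
            (forall n : nat, (n < N)%N -> alpha n != 0 ->
               exp_sum y (alpha n) = 0) ->
            ((quad_error l rho Yt ^+ 2)%:E <=
             \sum_(N <= n <oo)
               (rho (alpha n) / N%:R ^+ 2
                * ComplexField.Normc.normc (exp_sum y (alpha n)) ^+ 2)%:E)%E]].
Proof.
split.
- by move=> x y; exact: Kper_complexE.
- exact: Kper_weakly_admissible.
- exact: Kper_admissible.
- exact: Kper_periodic.
move=> N N0; split.
- by move=> Y _; rewrite quad_error_sqrK.
- by move=> phi Y phiH _; exact: rkhs_quadrature.
- exact: quad_argmin_exists.
move=> Yt alpha y [_ Yt_min] alpha_ord y0.
have [Z Zcell ZE] := quad_error_representative rho l_basis y.
apply: (@le_trans _ _ (quad_error_sqr l rho y)%:E).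
  rewrite lee_fin -quad_error_sqrK // ler_sqr ?nnegrE ?sqrtr_ge0 // -ZE.
  exact: Yt_min.
apply: le_trans (quad_error_sqr_le_tail rho_l1 rho_ge0 rho_0 N0 alpha_ord y0) _.
rewrite le_eqVlt; apply/orP; left; apply/eqP; apply: eq_eseriesr => n _.
by congr EFin; rewrite comb_freq_sample mulrA mulrAC.
Qed.
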